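(* For $r\ge1$ let $\sigma_r:=\sqrt{\mathrm{Var}(\mu^{(r)})}>0$ and let $\widetilde\mu^{(r)}$ be the probability measure on $\mathbb{R}$ supported on $\{d/\sigma_r:d\in\mathbb{Z}\}$ with $\widetilde\mu^{(r)}(\{d/\sigma_r\})=\mu^{(r)}(d)$ for all $d\in\mathbb{Z}$. Then $\widetilde\mu^{(r)}$ converges in distribution to the standard normal law $\mathcal{N}(0,1)$ as $\rho(r)\to\infty$; that is, for every sequence of integers $r_n\ge1$ with $\rho(r_n)\to\infty$, $\widetilde\mu^{(r_n)}\to\mathcal{N}(0,1)$ in distribution.
   Context: Fix an integer $b\ge 2$. Every $n\in\mathbb{N}$ has a unique base-$b$ expansion $n=\sum_{k\ge0}n_kb^k$ with digits in $\{0,\dots,b-1\}$; $s(n):=\sum_k n_k$. For $r,n\in\mathbb{N}$ put $\Delta^{(r)}(n):=s(n+r)-s(n)$, and for $d\in\mathbb{Z}$, $\mu^{(r)}(d):=\lim_{N\to\infty}\frac1N|\{n<N:\Delta^{(r)}(n)=d\}|$; these limits exist and define a probability measure on $\mathbb{Z}$ with finite moments, and $\mathrm{Var}(\mu^{(r)})>0$ for $r\ge1$. Blocks: write the expansion of $r\ge1$ as the digit string $r_\ell\cdots r_0$ with $r_\ell\ne0$. A block is either a maximal run of consecutive $0$ digits, or a maximal run of consecutive digits equal to $b-1$, or (when $b\ge3$) a single digit with value in $\{1,\dots,b-2\}$. $\rho(r)$ is the number of blocks of $r$. *)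

(* Defs.v *)
From Stdlib Require Import Reals Lra Lia ZArith Arith List.
From Coquelicot Require Import Coquelicot.
Open Scope R_scope.

Definition digit (b n k : nat) : nat := ((n / b ^ k) mod b)%nat.

(* s(n): base-b digit sum. For b >= 2, b^k > n for k >= n, so positions
   0..n cover all digits. *)
Definition digsum (b n : nat) : nat :=
  fold_right Nat.add 0%nat (map (digit b n) (seq 0 (S n))).

Definition Delta (b r n : nat) : Z :=
  (Z.of_nat (digsum b (n + r)) - Z.of_nat (digsum b n))%Z.

Definition cnt (b r : nat) (d : Z) (N : nat) : nat :=
  length (filter (fun n => Z.eqb (Delta b r n) d) (seq 0 N)).

Definition mu (b r : nat) (d : Z) : R :=
  real (Lim_seq (fun N => INR (cnt b r d N) / INR N)).

Definition zsum (f : Z -> R) : R :=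
  Series (fun k => f (Z.of_nat k)) + Series (fun k => f (- Z.of_nat (S k))%Z).

Definition mean_mu (b r : nat) : R := zsum (fun d => IZR d * mu b r d).
Definition var_mu (b r : nat) : R :=
  zsum (fun d => (IZR d) ^ 2 * mu b r d) - (mean_mu b r) ^ 2.
Definition sigma (b r : nat) : R := sqrt (var_mu b r).

Definition cdf_tilde (b r : nat) (x : R) : R :=
  zsum (fun d => if Rle_dec (IZR d / sigma b r) x then mu b r d else 0).

Definition Phi (x : R) : R :=
  RInt_gen (fun t => / sqrt (2 * PI) * exp (- (t ^ 2) / 2))
           (Rbar_locally m_infty) (at_point x).

Definition dclass (b c : nat) : nat :=
  if Nat.eqb c 0 then 0%nat else if Nat.eqb c (b - 1) then 1%nat else 2%nat.

(* position k (0 <= k <= l, i.e. b^k <= r) starts a new block when reading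
   from r_0 upward: k = 0, or r_k is a single-digit block in {1..b-2},
   or r_k is in a different class from r_(k-1). *)
Definition block_start (b r k : nat) : bool :=
  Nat.leb (b ^ k) r &&
  (Nat.eqb k 0 || Nat.eqb (dclass b (digit b r k)) 2 ||
   negb (Nat.eqb (dclass b (digit b r k)) (dclass b (digit b r (k - 1))))).

Definition rho (b r : nat) : nat :=
  length (filter (block_start b r) (seq 0 (S r))).

(* convergence in distribution of a sequence of laws given by distribution
   functions F n to N(0,1): F n x -> Phi x at every x (Phi is continuous) *)
Definition conv_dist_std_normal (F : nat -> R -> R) : Prop :=
  forall x : R, is_lim_seq (fun n => F n x) (Phi x).

(* Main.v *)
Require Import Defs.
From Stdlib Require Import Reals Lra Lia ZArith Arith List.
From Coquelicot Require Import Coquelicot.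
Open Scope R_scope.

(** Reading the lowest digit [c] of [b * r + c] shows that [mu b (b * r + c)] is the mixture
    of [mu b r] shifted by [c], with weight [(b - c) / b], and of [mu b (S r)] shifted by
    [c - b], with weight [c / b], the probability of a carry. Hence all means vanish, and the
    variances [V] satisfy
    [V (b * r + c) = (b - c) / b * V r + c / b * V (S r) + c * (b - c)] with bounded
    increments [V (S r) - V r].

    Let [g t x] be the probability that [sqrt t * Z <= x] for a standard normal [Z]; it solves
    the heat equation. Replacing [E_r g (e, x + h Delta)] by [g (e + h^2 V r, x)] at both ends
    of the recursion, the terms of order [h] and [h^2] cancel, so a digit creates an error of
    order [h^3], and none at all if it is [0]. By the maximum principle for the recursion, the
    total error is [O(h^3 V r)], which is [O(h)] for [h = - 1 / sigma]. Letting [e] tend to 0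
    turns [g (e, .)] into an indicator function.

    It remains to see that [V r] tends to infinity with the number of blocks. With
    [D r = V (S r) - V r], the quantity [V + D / 2 + D^2 / 4] grows by a multiple of
    [b^2 - D^2] at each digit, and [b^2 - D^2] is at least [2] where the block changes. *)

(** * Taylor bounds on a segment *)

Definition segment (x y z : R) : Prop := Rmin x y <= z <= Rmax x y.

Lemma MVT_segment (f df : R -> R) (x y : R) :
  (forall z, segment x y z -> is_derive f z (df z)) ->
  exists z, segment x y z /\ f y - f x = df z * (y - x).
Proof.
  intros Df. apply MVT_gen.
  - intros z Hz. apply Df. unfold segment. lra.
  - intros z Hz. apply continuity_pt_filterlim, (ex_derive_continuous f).
    eexists. now apply Df.
Qed.

Lemma segment_trans (x y z w : R) :
  segment x y z -> segment x z w -> segment x y w.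
Proof. unfold segment, Rmin, Rmax. repeat destruct (Rle_dec _ _); lra. Qed.

Lemma segment_dist_le (x y z : R) :
  segment x y z -> Rabs (z - x) <= Rabs (y - x).
Proof. unfold segment. rewrite Rmin_comm, Rmax_comm. apply Rabs_le_between_min_max. Qed.

Lemma increment_le_pow (f df : R -> R) (x y M : R) (n : nat) : 0 <= M ->
  (forall z, segment x y z -> is_derive f z (df z)) ->
  (forall z, segment x y z -> Rabs (df z) <= M * Rabs (z - x) ^ n) ->
  Rabs (f y - f x) <= M * Rabs (y - x) ^ S n.
Proof.
  intros HM Df Bdf. destruct (MVT_segment f df x y Df) as [z [Hz ->]].
  rewrite Rabs_mult, <- tech_pow_Rmult, (Rmult_comm (Rabs (y - x))), <- Rmult_assoc.
  apply Rmult_le_compat_r; [apply Rabs_pos|].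
  eapply Rle_trans; [now apply Bdf|]. apply Rmult_le_compat_l; [exact HM|].
  apply pow_incr. split; [apply Rabs_pos|now apply segment_dist_le].
Qed.

Lemma taylor_remainder_2 (f f1 f2 : R -> R) (x y M : R) : 0 <= M ->
  (forall z, segment x y z -> is_derive f z (f1 z)) ->
  (forall z, segment x y z -> is_derive f1 z (f2 z)) ->
  (forall z, segment x y z -> Rabs (f2 z) <= M) ->
  Rabs (f y - f x - (y - x) * f1 x) <= M * Rabs (y - x) ^ 2.
Proof.
  intros HM Df Df1 B2.
  replace (f y - f x - (y - x) * f1 x)
    with ((f y - y * f1 x) - (f x - x * f1 x)) by ring.
  apply (increment_le_pow (fun z => f z - z * f1 x) (fun z => f1 z - f1 x)); [exact HM| |].
  - intros z Hz. apply @is_derive_minus; [now apply Df|]. auto_derive; [exact I|ring].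
  - intros z Hz. apply (increment_le_pow f1 f2 x z M 0 HM).
    + intros w Hw. apply Df1. now apply segment_trans with z.
    + intros w Hw. rewrite pow_O, Rmult_1_r. apply B2. now apply segment_trans with z.
Qed.

Lemma taylor_remainder_3 (f f1 f2 f3 : R -> R) (x y M : R) : 0 <= M ->
  (forall z, segment x y z -> is_derive f z (f1 z)) ->
  (forall z, segment x y z -> is_derive f1 z (f2 z)) ->
  (forall z, segment x y z -> is_derive f2 z (f3 z)) ->
  (forall z, segment x y z -> Rabs (f3 z) <= M) ->
  Rabs (f y - f x - (y - x) * f1 x - (y - x) ^ 2 / 2 * f2 x) <= M * Rabs (y - x) ^ 3.
Proof.
  intros HM Df Df1 Df2 B3.
  replace (f y - f x - (y - x) * f1 x - (y - x) ^ 2 / 2 * f2 x)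
    with ((f y - y * f1 x - (y - x) ^ 2 / 2 * f2 x)
          - (f x - x * f1 x - (x - x) ^ 2 / 2 * f2 x)) by field.
  apply (increment_le_pow (fun z => f z - z * f1 x - (z - x) ^ 2 / 2 * f2 x)
           (fun z => f1 z - f1 x - (z - x) * f2 x)); [exact HM| |].
  - intros z Hz. apply @is_derive_minus; [apply @is_derive_minus; [now apply Df|]|];
      (auto_derive; [exact I|field]).
  - intros z Hz. apply (taylor_remainder_2 f1 f2 f3); [exact HM| | |];
      intros w Hw; [apply Df1|apply Df2|apply B3]; now apply segment_trans with z.
Qed.

(** * The supremum norm *)

(* For unbounded [f] the value is [real p_infty = 0]. *)
Definition sup_norm (f : R -> R) : R := real (Lub_Rbar (fun y => exists x, y = Rabs (f x))).

Lemma sup_norm_spec (f : R -> R) (K : R) : (forall x, Rabs (f x) <= K) ->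
  (forall x, Rabs (f x) <= sup_norm f) /\ sup_norm f <= K.
Proof.
  intros HK. unfold sup_norm.
  destruct (Lub_Rbar_correct (fun y => exists x, y = Rabs (f x))) as [Hub Hleast].
  assert (Hle : Rbar_le (Lub_Rbar (fun y => exists x, y = Rabs (f x))) K).
  { apply Hleast. intros y [x ->]. apply HK. }
  destruct (Lub_Rbar _) as [l| |]; simpl in Hle.
  - split; [|exact Hle]. intros x. apply Hub. now exists x.
  - contradiction.
  - destruct (Hub (Rabs (f 0))). now exists 0.
Qed.

(** * Second order expansion of solutions of the heat equation *)

(* The remainder has order 3 in [y] when [s] has order 2, which is the scaling of the heat
   equation [g_t = g_xx / 2]; [gx] and [gxx] stand for the partial derivatives. *)
Definition heat_expansion (e M : R) (g gx gxx : R -> R -> R) : Prop :=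
  forall t s x y, e <= t -> e <= t + s ->
  Rabs (g (t + s) (x + y) - g t x - y * gx t x - (s + y ^ 2) / 2 * gxx t x)
  <= M * (Rabs s ^ 2 + Rabs s * Rabs y + Rabs y ^ 3).

Section HeatEquation.

Variables (g gx gxx gxxx gtt : R -> R -> R) (e M : R).
Hypothesis HM : 0 <= M.
Hypothesis Dx : forall t x, e <= t -> is_derive (g t) x (gx t x).
Hypothesis Dxx : forall t x, e <= t -> is_derive (gx t) x (gxx t x).
Hypothesis Dxxx : forall t x, e <= t -> is_derive (gxx t) x (gxxx t x).
Hypothesis Dt : forall t x, e <= t -> is_derive (fun u => g u x) t (gxx t x / 2).
Hypothesis Dtt : forall t x, e <= t -> is_derive (fun u => gxx u x / 2) t (gtt t x).
Hypothesis Bxxx : forall t x, e <= t -> Rabs (gxxx t x) <= M.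
Hypothesis Btt : forall t x, e <= t -> Rabs (gtt t x) <= M.

Lemma heat_gxx_lipschitz (t x y : R) : e <= t ->
  Rabs (gxx t (x + y) - gxx t x) <= M * Rabs y.
Proof.
  intros Ht. replace (Rabs y) with (Rabs (x + y - x) ^ 1) by (rewrite pow_1; f_equal; ring).
  apply (increment_le_pow (gxx t) (gxxx t) x (x + y) M 0 HM).
  - intros z _. now apply Dxxx.
  - intros z _. rewrite pow_O, Rmult_1_r. now apply Bxxx.
Qed.

Lemma heat_taylor_space (t x y : R) : e <= t ->
  Rabs (g t (x + y) - g t x - y * gx t x - y ^ 2 / 2 * gxx t x) <= M * Rabs y ^ 3.
Proof.
  intros Ht. replace y with (x + y - x) at 2 3 4 by ring.
  apply (taylor_remainder_3 (g t) (gx t) (gxx t) (gxxx t)); auto.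
Qed.

Lemma heat_taylor_time (t s x : R) : e <= t -> e <= t + s ->
  Rabs (g (t + s) x - g t x - s * (gxx t x / 2)) <= M * Rabs s ^ 2.
Proof.
  intros Ht Hs. replace s with (t + s - t) at 2 3 by ring.
  assert (He : forall u, segment t (t + s) u -> e <= u).
  { unfold segment, Rmin. intros u. destruct (Rle_dec _ _); lra. }
  apply (taylor_remainder_2 (fun u => g u x) (fun u => gxx u x / 2) (fun u => gtt u x)); auto.
Qed.

Lemma heat_equation_expansion : heat_expansion e M g gx gxx.
Proof.
  intros t s x y Ht Hs.
  replace (g (t + s) (x + y) - g t x - y * gx t x - (s + y ^ 2) / 2 * gxx t x)
    with ((g (t + s) (x + y) - g t (x + y) - s * (gxx t (x + y) / 2))
          + s / 2 * (gxx t (x + y) - gxx t x)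
          + (g t (x + y) - g t x - y * gx t x - y ^ 2 / 2 * gxx t x)) by field.
  rewrite !Rmult_plus_distr_l.
  eapply Rle_trans; [apply Rabs_triang|]. apply Rplus_le_compat; [|now apply heat_taylor_space].
  eapply Rle_trans; [apply Rabs_triang|]. apply Rplus_le_compat; [now apply heat_taylor_time|].
  rewrite Rabs_mult. assert (H := heat_gxx_lipschitz t x y Ht).
  replace (M * (Rabs s * Rabs y)) with (Rabs s * (M * Rabs y)) by ring.
  apply Rmult_le_compat; auto using Rabs_pos.
  unfold Rdiv. rewrite Rabs_mult, (Rabs_right (/ 2)) by lra. generalize (Rabs_pos s). lra.
Qed.

End HeatEquation.

Lemma heat_expansion_scaled (e M h A B : R) (g gx gxx : R -> R -> R) (t s x y : R) :
  heat_expansion e M g gx gxx -> 0 <= M -> Rabs h <= 1 -> e <= t -> e <= t + h ^ 2 * s ->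
  Rabs s <= A -> Rabs y <= B ->
  Rabs (g (t + h ^ 2 * s) (x + h * y) - g t x - h * y * gx t x
        - h ^ 2 * (s + y ^ 2) / 2 * gxx t x)
  <= M * (A ^ 2 + A * B + B ^ 3) * Rabs h ^ 3.
Proof.
  intros Hg HM Hh Ht Hs HA HB.
  replace (h ^ 2 * (s + y ^ 2)) with (h ^ 2 * s + (h * y) ^ 2) by ring.
  eapply Rle_trans; [now apply Hg|].
  rewrite Rmult_assoc. apply Rmult_le_compat_l; [exact HM|].
  assert (Hk0 := Rabs_pos h). assert (Hu0 := Rabs_pos s). assert (Hv0 := Rabs_pos y).
  rewrite !Rabs_mult, <- RPow_abs.
  set (k := Rabs h) in *. set (u := Rabs s) in *. set (v := Rabs y) in *.
  replace ((k ^ 2 * u) ^ 2 + k ^ 2 * u * (k * v) + (k * v) ^ 3)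
    with ((k * u ^ 2 + u * v + v ^ 3) * k ^ 3) by ring.
  apply Rmult_le_compat_r; [now apply pow_le|].
  assert (u ^ 2 <= A ^ 2) by now apply pow_incr.
  assert (v ^ 3 <= B ^ 3) by now apply pow_incr.
  assert (u * v <= A * B) by now apply Rmult_le_compat.
  assert (k * u ^ 2 <= 1 * u ^ 2) by (apply Rmult_le_compat_r; [apply pow2_ge_0|exact Hh]).
  lra.
Qed.

(** * The standard normal distribution *)

Definition gauss (x : R) : R := / sqrt (2 * PI) * exp (- (x ^ 2) / 2).

Lemma sqrt_2PI_gt_1 : 1 < sqrt (2 * PI).
Proof. rewrite <- sqrt_1 at 1. apply sqrt_lt_1; generalize PI2_1; lra. Qed.

Lemma is_derive_gauss (x : R) : is_derive gauss x (- x * gauss x).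
Proof.
  assert (H := sqrt_2PI_gt_1). unfold gauss. auto_derive; [exact I|].
  change (x * (x * 1)) with (x ^ 2). unfold Rdiv. field. lra.
Qed.

Lemma continuous_gauss (x : R) : continuous gauss x.
Proof. apply (ex_derive_continuous gauss). eexists. apply is_derive_gauss. Qed.

Lemma gauss_pos (x : R) : 0 < gauss x.
Proof.
  apply Rmult_lt_0_compat; [|apply exp_pos].
  apply Rinv_0_lt_compat. generalize sqrt_2PI_gt_1. lra.
Qed.

Lemma gauss_opp (x : R) : gauss (- x) = gauss x.
Proof. unfold gauss. do 3 f_equal. ring. Qed.

Lemma gauss_le (x : R) : gauss x * (1 + x ^ 2 / 4) ^ 2 <= 1.
Proof.
  assert (Hx := pow2_ge_0 x).
  assert (Hexp : exp (- (x ^ 2) / 2) * exp (x ^ 2 / 4) ^ 2 = 1).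
  { rewrite <- Rsqr_pow2 with (x := exp _). unfold Rsqr.
    rewrite <- !exp_plus, <- exp_0. f_equal. field. }
  assert (Hpow : (1 + x ^ 2 / 4) ^ 2 <= exp (x ^ 2 / 4) ^ 2).
  { apply pow_incr. split; [lra|apply exp_ineq1_le]. }
  assert (Hinv : / sqrt (2 * PI) <= 1).
  { rewrite <- Rinv_1. apply Rinv_le_contravar; generalize sqrt_2PI_gt_1; lra. }
  eapply Rle_trans; [|right; exact Hexp]. apply Rmult_le_compat.
  - apply Rlt_le, gauss_pos.
  - apply pow2_ge_0.
  - unfold gauss. rewrite <- (Rmult_1_l (exp _)) at 2.
    apply Rmult_le_compat_r; [apply Rlt_le, exp_pos|exact Hinv].
  - exact Hpow.
Qed.

Lemma gauss_mul_le (p x : R) : Rabs p <= 4 * (1 + x ^ 2 / 4) ^ 2 -> Rabs (p * gauss x) <= 4.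
Proof.
  intros Hp. assert (P := gauss_pos x). assert (H := gauss_le x).
  rewrite Rabs_mult, (Rabs_right (gauss x)) by lra. nra.
Qed.

Lemma is_lim_gauss_p : is_lim gauss p_infty 0.
Proof.
  apply (is_lim_le_le_loc (fun _ => 0) (fun x => / x)).
  - exists 0. intros x Hx. assert (P := gauss_pos x). assert (H := gauss_le x).
    split; [lra|]. apply Rmult_le_reg_r with x; [exact Hx|]. rewrite Rinv_l by lra.
    assert (x <= (1 + x ^ 2 / 4) ^ 2).
    { assert (0 <= (x / 2 - 1) ^ 2) by apply pow2_ge_0. nra. }
    nra.
  - apply is_lim_const.
  - apply (is_lim_inv (fun x => x) p_infty p_infty); [apply is_lim_id|discriminate].
Qed.

Definition half_Phi (x : R) : R := RInt gauss 0 x.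

Lemma ex_RInt_gauss (x y : R) : ex_RInt gauss x y.
Proof. apply (ex_RInt_continuous gauss). intros; apply continuous_gauss. Qed.

Lemma is_derive_half_Phi (x : R) : is_derive half_Phi x (gauss x).
Proof.
  apply is_derive_RInt with 0.
  - apply filter_forall. intros y. apply (RInt_correct gauss), ex_RInt_gauss.
  - apply continuous_gauss.
Qed.

Lemma half_Phi_opp (x : R) : half_Phi (- x) = - half_Phi x.
Proof.
  unfold half_Phi.
  replace (- x) with (-1 * x + 0) by ring. replace 0 with (-1 * 0 + 0) at 1 by ring.
  rewrite <- (RInt_comp_lin gauss (-1) 0 0 x) by apply ex_RInt_gauss.
  rewrite (RInt_ext _ (fun t => opp (gauss t))).
  - apply (RInt_opp gauss), ex_RInt_gauss.
  - intros t _. rewrite <- (gauss_opp t). replace (-1 * t + 0) with (- t) by ring.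
    unfold scal, opp; simpl; unfold mult; simpl. ring.
Qed.

(* [polar_int x] is the integral of [gauss u * gauss v] over the part of the quadrant outside
   the square [[0, x]^2]: twice the part below the diagonal, where [v = t * u]. *)
Definition polar (x t : R) : R := 2 * gauss x * gauss (x * t) / (1 + t ^ 2).
Definition polar_int (x : R) : R := RInt (polar x) 0 1.

Lemma continuous_polar (x t : R) : continuous (polar x) t.
Proof.
  apply (ex_derive_continuous (polar x)). unfold polar, gauss. auto_derive. nra.
Qed.

Lemma ex_RInt_polar (x u v : R) : ex_RInt (polar x) u v.
Proof. apply (ex_RInt_continuous (polar x)). intros; apply continuous_polar. Qed.

Lemma is_derive_polar (x t : R) :
  is_derive (fun u => polar u t) x (- (2 * gauss x) * (x * gauss (x * t + 0))).
Proof.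
  assert (H := sqrt_2PI_gt_1). rewrite Rplus_0_r.
  unfold polar, gauss. auto_derive; [nra|]. simpl. unfold Rdiv. field. split; nra.
Qed.

Lemma is_derive_polar_int (x : R) :
  is_derive polar_int x (- (2 * gauss x) * half_Phi x).
Proof.
  assert (Dpolar : forall u t, Derive (fun z => polar z t) u
                               = - (2 * gauss u) * (u * gauss (u * t + 0))).
  { intros u t. apply is_derive_unique, is_derive_polar. }
  replace (- (2 * gauss x) * half_Phi x)
    with (RInt (fun t => Derive (fun u => polar u t) x) 0 1).
  - apply is_derive_RInt_param.
    + apply filter_forall. intros y t _. eexists. apply is_derive_polar.
    + intros t _. eapply continuity_2d_pt_ext; [intros u v; symmetry; apply Dpolar|].
      repeat first
        [ apply (continuity_1d_2d_pt_comp gauss);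
          [apply continuity_pt_filterlim, continuous_gauss|]
        | apply continuity_2d_pt_mult | apply continuity_2d_pt_opp
        | apply continuity_2d_pt_plus | apply continuity_2d_pt_const
        | apply continuity_2d_pt_id1 | apply continuity_2d_pt_id2 ].
    + apply filter_forall. intros y. apply ex_RInt_polar.
  - rewrite (RInt_ext _ (fun t => scal (- (2 * gauss x)) (scal x (gauss (x * t + 0)))))
      by (intros t _; apply Dpolar).
    etransitivity.
    { apply (RInt_scal (fun t => scal x (gauss (x * t + 0)))).
      apply (ex_RInt_comp_lin gauss), ex_RInt_gauss. }
    etransitivity.
    { apply f_equal. apply (RInt_comp_lin gauss x 0 0 1), ex_RInt_gauss. }
    rewrite Rmult_0_r, Rmult_1_r, !Rplus_0_r. reflexivity.
Qed.

Lemma polar_int_0 : polar_int 0 = 1 / 4.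
Proof.
  assert (Hpi := PI_RGT_0).
  assert (Hgauss : 2 * gauss 0 * gauss 0 = / PI).
  { assert (H := sqrt_2PI_gt_1). assert (Hsqr := sqrt_sqrt (2 * PI) ltac:(lra)).
    unfold gauss. replace (- 0 ^ 2 / 2) with 0 by field. rewrite exp_0.
    apply Rmult_eq_reg_r with (sqrt (2 * PI) * sqrt (2 * PI)); [|nra].
    rewrite Hsqr at 2. field. lra. }
  assert (Hatan : is_RInt (fun t => / (1 + t ^ 2)) 0 1 (minus (atan 1) (atan 0))).
  { apply (is_RInt_derive atan); intros t _.
    - rewrite <- Rsqr_pow2. apply is_derive_atan.
    - apply (ex_derive_continuous (fun t => / (1 + t ^ 2))). auto_derive. nra. }
  unfold polar_int.
  rewrite (RInt_ext _ (fun t => scal (/ PI) (/ (1 + t ^ 2)))).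
  - rewrite (RInt_scal (fun t => / (1 + t ^ 2))) by (eexists; exact Hatan).
    rewrite (is_RInt_unique _ _ _ _ Hatan), atan_1, atan_0.
    unfold minus, plus, opp, scal; simpl; unfold mult; simpl. field. lra.
  - intros t _. unfold polar. rewrite Rmult_0_l, Hgauss. reflexivity.
Qed.

Lemma half_Phi_sqr (x : R) : half_Phi x ^ 2 + polar_int x = 1 / 4.
Proof.
  assert (D0 : forall y, is_derive (fun u => half_Phi u ^ 2 + polar_int u) y 0).
  { intros y.
    replace 0 with (plus (INR 2 * gauss y * half_Phi y ^ 1) (- (2 * gauss y) * half_Phi y))
      by (unfold plus; simpl; ring).
    apply (is_derive_plus (fun u => half_Phi u ^ 2)); [|apply is_derive_polar_int].
    apply (is_derive_pow half_Phi 2), is_derive_half_Phi. }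
  destruct (MVT_segment _ (fun _ => 0) 0 x (fun y _ => D0 y)) as [c [_ E]].
  rewrite <- polar_int_0. assert (Hzero : half_Phi 0 = 0) by exact (RInt_point 0 gauss).
  rewrite Hzero in E. lra.
Qed.

Lemma polar_int_bounds (x : R) : 0 <= polar_int x <= 2 * gauss x.
Proof.
  assert (P := gauss_pos x).
  unfold polar_int. split.
  - apply RInt_ge_0; [lra|apply ex_RInt_polar|].
    intros t _. assert (Pt := gauss_pos (x * t)).
    apply Rdiv_le_0_compat; nra.
  - replace (2 * gauss x) with (RInt (fun _ => 2 * gauss x) 0 1)
      by (rewrite RInt_const; unfold scal; simpl; unfold mult; simpl; ring).
    apply RInt_le; [lra|apply ex_RInt_polar|apply ex_RInt_const|].
    intros t _. unfold polar. apply Rle_div_l; [nra|].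
    assert (Hxt := gauss_le (x * t)).
    assert (1 <= (1 + (x * t) ^ 2 / 4) ^ 2).
    {  nra. }
    assert (gauss (x * t) <= 1 + t ^ 2) by nra. nra.
Qed.

Lemma is_lim_half_Phi_p : is_lim half_Phi p_infty (1 / 2).
Proof.
  apply is_lim_ext_loc with (fun x => sqrt (1 / 4 - polar_int x)).
  { exists 0. intros x Hx. rewrite <- (half_Phi_sqr x).
    replace (half_Phi x ^ 2 + polar_int x - polar_int x) with (half_Phi x ^ 2) by ring.
    apply sqrt_pow2. apply RInt_ge_0; [lra|apply ex_RInt_gauss|].
    intros t _. apply Rlt_le, gauss_pos. }
  replace (1 / 2) with (sqrt (1 / 4 - 0))
    by (rewrite Rminus_0_r; replace (1 / 4) with ((1 / 2) ^ 2) by field; apply sqrt_pow2; lra).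
  apply (is_lim_comp_continuous (fun x => 1 / 4 - polar_int x)); [|apply continuous_sqrt].
  apply is_lim_minus'; [apply is_lim_const|].
  apply (is_lim_le_le_loc (fun _ => 0) (fun x => 2 * gauss x)).
  - exists 0. intros x _. apply polar_int_bounds.
  - apply is_lim_const.
  - replace (Finite 0) with (Rbar_mult 2 0) by (simpl; f_equal; ring).
    apply is_lim_scal_l, is_lim_gauss_p.
Qed.

Lemma is_lim_half_Phi_m : is_lim half_Phi m_infty (- (1 / 2)).
Proof.
  apply is_lim_ext with (fun x => - half_Phi (- x)).
  { intros x. rewrite half_Phi_opp. ring. }
  apply (is_lim_opp (fun x => half_Phi (- x)) m_infty (1 / 2)).
  apply (is_lim_comp half_Phi (fun x => - x) m_infty (1 / 2) p_infty).
  - apply is_lim_half_Phi_p.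
  - apply (is_lim_opp (fun x => x) m_infty m_infty), is_lim_id.
  - exists 0. intros; discriminate.
Qed.

Lemma Phi_half_Phi (x : R) : Phi x = 1 / 2 + half_Phi x.
Proof.
  assert (DE : forall y, Derive half_Phi y = gauss y).
  { intros y. apply is_derive_unique, is_derive_half_Phi. }
  apply is_RInt_gen_unique.
  apply (is_RInt_gen_ext (Derive half_Phi)).
  { apply filter_forall. intros ab y _. apply DE. }
  replace (1 / 2 + half_Phi x) with (half_Phi x - - (1 / 2)) by ring.
  apply is_RInt_gen_Derive.
  - apply filter_forall. intros ab y _. eexists. apply is_derive_half_Phi.
  - apply filter_forall. intros ab y _.
    apply (continuous_ext gauss); [intros z; symmetry; apply DE|apply continuous_gauss].
  - apply is_lim_half_Phi_m.
  - intros P HP. apply (locally_singleton (half_Phi x) P HP).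
Qed.

Lemma Phi_opp (x : R) : Phi (- x) = 1 - Phi x.
Proof. rewrite !Phi_half_Phi, half_Phi_opp. field. Qed.

Lemma is_derive_Phi (x : R) : is_derive Phi x (gauss x).
Proof.
  apply (is_derive_ext (fun y => plus (1 / 2) (half_Phi y))).
  { intros y. symmetry. apply Phi_half_Phi. }
  replace (gauss x) with (plus 0 (gauss x)) by apply (plus_zero_l (gauss x)).
  apply (is_derive_plus (fun _ => 1 / 2)); [apply @is_derive_const|apply is_derive_half_Phi].
Qed.

Lemma continuous_Phi (x : R) : continuous Phi x.
Proof. apply (ex_derive_continuous Phi). eexists. apply is_derive_Phi. Qed.

Lemma Phi_incr (x y : R) : x <= y -> Phi x <= Phi y.
Proof.
  intros Hxy. destruct (MVT_segment Phi gauss x y) as [z [_ E]].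
  - intros z _. apply is_derive_Phi.
  - generalize (gauss_pos z). nra.
Qed.

Lemma Phi_bounds (x : R) : 0 <= Phi x <= 1.
Proof.
  assert (H := half_Phi_sqr x). assert (P := polar_int_bounds x).
  rewrite Phi_half_Phi. nra.
Qed.

Lemma is_lim_Phi_m : is_lim Phi m_infty 0.
Proof.
  apply is_lim_ext with (fun x => 1 / 2 + half_Phi x).
  { intros x. symmetry. apply Phi_half_Phi. }
  replace 0 with (1 / 2 + - (1 / 2)) by ring.
  apply is_lim_plus'; [apply is_lim_const|apply is_lim_half_Phi_m].
Qed.

(** * The heat kernel *)

(* With [Z] standard normal, [heat t x] is the probability that [sqrt t * Z <= x]. *)
Definition heat (t x : R) : R := Phi (x / sqrt t).
Definition heat_x (t x : R) : R := / sqrt t * gauss (x / sqrt t).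
Definition heat_xx (t x : R) : R := - x / t * heat_x t x.
Definition heat_xxx (t x : R) : R := (x ^ 2 / t ^ 2 - / t) * heat_x t x.
Definition heat_tt (t x : R) : R := (3 * x / t ^ 2 - x ^ 3 / t ^ 3) / 4 * heat_x t x.

Lemma heat_bounded (t x : R) : Rabs (heat t x) <= 1.
Proof. apply Rabs_le. generalize (Phi_bounds (x / sqrt t)). unfold heat. lra. Qed.

Lemma heat_opp (t x : R) : heat t (- x) = 1 - heat t x.
Proof. unfold heat. rewrite <- Phi_opp. f_equal. unfold Rdiv. ring. Qed.

Lemma heat_incr (t x y : R) : 0 < t -> x <= y -> heat t x <= heat t y.
Proof.
  intros Ht Hxy. apply Phi_incr, Rmult_le_compat_r; [|exact Hxy].
  apply Rlt_le, Rinv_0_lt_compat, sqrt_lt_R0, Ht.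
Qed.

Lemma is_derive_gauss_comp (f : R -> R) (x l : R) : is_derive f x l ->
  is_derive (fun u => gauss (f u)) x (l * (- f x * gauss (f x))).
Proof. apply (is_derive_comp gauss f), is_derive_gauss. Qed.

Lemma is_derive_Rmult (f g : R -> R) (x df dg : R) : is_derive f x df -> is_derive g x dg ->
  is_derive (fun u => f u * g u) x (df * g x + f x * dg).
Proof. intros Df Dg. apply (is_derive_mult f g); [exact Df|exact Dg|exact Rmult_comm]. Qed.

Section HeatKernel.

Variables (t x : R).
Hypothesis Ht : 0 < t.

Lemma is_derive_standardize_space : is_derive (fun u => u / sqrt t) x (/ sqrt t).
Proof. assert (Hs := sqrt_lt_R0 t Ht). auto_derive; [exact I|field; lra]. Qed.

Lemma is_derive_inv_sqrt : is_derive (fun u => / sqrt u) t (- / (2 * t * sqrt t)).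
Proof.
  assert (Hs := sqrt_lt_R0 t Ht). assert (Hss := sqrt_sqrt t (Rlt_le _ _ Ht)).
  auto_derive; [split; [exact Ht|split; [lra|exact I]]|].
  set (s := sqrt t) in *. rewrite <- Hss. field. lra.
Qed.

Lemma is_derive_standardize_time : is_derive (fun u => x / sqrt u) t (x * - / (2 * t * sqrt t)).
Proof. exact (is_derive_scal (fun u => / sqrt u) t x _ is_derive_inv_sqrt). Qed.

Lemma is_derive_heat : is_derive (heat t) x (heat_x t x).
Proof.
  apply (is_derive_comp Phi (fun u => u / sqrt t));
    [apply is_derive_Phi|apply is_derive_standardize_space].
Qed.

Lemma is_derive_heat_x : is_derive (heat_x t) x (heat_xx t x).
Proof.
  assert (Hs := sqrt_lt_R0 t Ht). assert (Hss := sqrt_sqrt t (Rlt_le _ _ Ht)).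
  replace (heat_xx t x)
    with (/ sqrt t * (/ sqrt t * (- (x / sqrt t) * gauss (x / sqrt t)))).
  - apply (is_derive_scal (fun u => gauss (u / sqrt t))).
    apply (is_derive_gauss_comp (fun u => u / sqrt t)), is_derive_standardize_space.
  - unfold heat_xx, heat_x. set (s := sqrt t) in *. rewrite <- Hss. field. lra.
Qed.

Lemma is_derive_heat_xx : is_derive (heat_xx t) x (heat_xxx t x).
Proof.
  replace (heat_xxx t x) with (- / t * heat_x t x + - x / t * heat_xx t x)
    by (unfold heat_xxx, heat_xx; field; lra).
  apply (is_derive_Rmult (fun u => - u / t)); [|apply is_derive_heat_x].
  auto_derive; [exact I|field; lra].
Qed.

Lemma is_derive_heat_time : is_derive (fun u => heat u x) t (heat_xx t x / 2).
Proof.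
  replace (heat_xx t x / 2) with (x * - / (2 * t * sqrt t) * gauss (x / sqrt t)).
  - apply (is_derive_comp Phi (fun u => x / sqrt u));
      [apply is_derive_Phi|apply is_derive_standardize_time].
  - assert (Hs := sqrt_lt_R0 t Ht). unfold heat_xx, heat_x. field. lra.
Qed.

Lemma is_derive_heat_x_time : is_derive (fun u => heat_x u x) t (heat_xxx t x / 2).
Proof.
  assert (Hs := sqrt_lt_R0 t Ht). assert (Hss := sqrt_sqrt t (Rlt_le _ _ Ht)).
  replace (heat_xxx t x / 2)
    with (- / (2 * t * sqrt t) * gauss (x / sqrt t)
          + / sqrt t * (x * - / (2 * t * sqrt t) * (- (x / sqrt t) * gauss (x / sqrt t)))).
  - apply (is_derive_Rmult (fun u => / sqrt u) (fun u => gauss (x / sqrt u)));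
      [apply is_derive_inv_sqrt|].
    apply (is_derive_gauss_comp (fun u => x / sqrt u)), is_derive_standardize_time.
  - unfold heat_xxx, heat_x. set (s := sqrt t) in *. rewrite <- Hss. field. lra.
Qed.

Lemma is_derive_heat_xx_time : is_derive (fun u => heat_xx u x / 2) t (heat_tt t x).
Proof.
  apply (is_derive_ext (fun u => - x / 2 * / u * heat_x u x)).
  { intros u. unfold heat_xx, Rdiv. simpl. ring. }
  replace (heat_tt t x)
    with (x / (2 * t ^ 2) * heat_x t x + - x / 2 * / t * (heat_xxx t x / 2))
    by (unfold heat_tt, heat_xxx; field; lra).
  apply (is_derive_Rmult (fun u => - x / 2 * / u) (fun u => heat_x u x));
    [|apply is_derive_heat_x_time].
  auto_derive; [lra|field; lra].
Qed.

Lemma heat_xxx_standardize :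
  heat_xxx t x = (/ sqrt t) ^ 3 * (((x / sqrt t) ^ 2 - 1) * gauss (x / sqrt t)).
Proof.
  assert (Hs := sqrt_lt_R0 t Ht). assert (Hss := sqrt_sqrt t (Rlt_le _ _ Ht)).
  unfold heat_xxx, heat_x. set (s := sqrt t) in *. rewrite <- Hss. field. lra.
Qed.

Lemma heat_tt_standardize :
  heat_tt t x = (/ sqrt t) ^ 4 *
    ((3 * (x / sqrt t) - (x / sqrt t) ^ 3) / 4 * gauss (x / sqrt t)).
Proof.
  assert (Hs := sqrt_lt_R0 t Ht). assert (Hss := sqrt_sqrt t (Rlt_le _ _ Ht)).
  unfold heat_tt, heat_x. set (s := sqrt t) in *. rewrite <- Hss. field. lra.
Qed.

End HeatKernel.

Lemma hermite_2_gauss_le (x : R) : Rabs ((x ^ 2 - 1) * gauss x) <= 4.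
Proof. apply gauss_mul_le, Rabs_le.  nra. Qed.

Lemma hermite_3_gauss_le (x : R) : Rabs ((3 * x - x ^ 3) / 4 * gauss x) <= 4.
Proof.
  apply gauss_mul_le, Rabs_le.
  assert (Hx := pow2_ge_0 x).
  assert (Hminus := pow2_ge_0 (x - 1)). assert (Hplus := pow2_ge_0 (x + 1)).
  assert (0 <= x ^ 2 * (x - 1) ^ 2) by now apply Rmult_le_pos.
  assert (0 <= x ^ 2 * (x + 1) ^ 2) by now apply Rmult_le_pos.
  nra.
Qed.

Lemma inv_sqrt_pow_mul_le (e t p : R) (n : nat) : 0 < e <= t -> Rabs p <= 4 ->
  Rabs ((/ sqrt t) ^ n * p) <= 4 * (/ sqrt e) ^ n.
Proof.
  intros [He Het] Hp.
  assert (Hle : 0 <= / sqrt t <= / sqrt e).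
  { split; [apply Rlt_le, Rinv_0_lt_compat, sqrt_lt_R0; lra|].
    apply Rinv_le_contravar; [now apply sqrt_lt_R0|now apply sqrt_le_1_alt]. }
  rewrite Rabs_mult, (Rmult_comm 4), (Rabs_right (_ ^ n)) by (apply Rle_ge, pow_le, Hle).
  apply Rmult_le_compat; [apply pow_le, Hle|apply Rabs_pos|now apply pow_incr|exact Hp].
Qed.

Lemma heat_expansion_heat (e : R) : 0 < e ->
  heat_expansion e (4 * (/ sqrt e) ^ 3 + 4 * (/ sqrt e) ^ 4) heat heat_x heat_xx.
Proof.
  intros He.
  assert (Hpow : forall n, 0 <= (/ sqrt e) ^ n).
  { intros n. apply pow_le, Rlt_le, Rinv_0_lt_compat, sqrt_lt_R0, He. }
  assert (Hpow3 := Hpow 3%nat). assert (Hpow4 := Hpow 4%nat).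
  apply (heat_equation_expansion heat heat_x heat_xx heat_xxx heat_tt); [lra|..];
    intros t x Ht; assert (T0 : 0 < t) by lra.
  - now apply is_derive_heat.
  - now apply is_derive_heat_x.
  - now apply is_derive_heat_xx.
  - now apply is_derive_heat_time.
  - now apply is_derive_heat_xx_time.
  - rewrite heat_xxx_standardize by exact T0.
    generalize (inv_sqrt_pow_mul_le e t _ 3 (conj He Ht) (hermite_2_gauss_le (x / sqrt t))).
    lra.
  - rewrite heat_tt_standardize by exact T0.
    generalize (inv_sqrt_pow_mul_le e t _ 4 (conj He Ht) (hermite_3_gauss_le (x / sqrt t))).
    lra.
Qed.

(** * Smoothing an indicator function *)

Definition indicator_le (x u : R) : R := if Rle_dec u x then 1 else 0.

Lemma indicator_le_bounded (x u : R) : Rabs (indicator_le x u) <= 1.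
Proof. apply Rabs_le. unfold indicator_le. destruct (Rle_dec u x); lra. Qed.

Lemma indicator_le_upper (t h x u : R) : 0 < t ->
  indicator_le x u <= heat t (x + h - u) + heat t (- h).
Proof.
  intros Ht. unfold indicator_le. destruct (Rle_dec u x) as [Hu|Hu].
  - assert (H := heat_incr t h (x + h - u) Ht ltac:(lra)). rewrite heat_opp. lra.
  - apply Rplus_le_le_0_compat; apply Phi_bounds.
Qed.

Lemma indicator_le_lower (t h x u : R) : 0 < t ->
  heat t (x - h - u) + - heat t (- h) <= indicator_le x u.
Proof.
  intros Ht. unfold indicator_le. destruct (Rle_dec u x) as [Hu|Hu].
  - assert (H := Phi_bounds ((x - h - u) / sqrt t)).
    assert (H' := Phi_bounds (- h / sqrt t)). unfold heat. lra.
  - assert (H := heat_incr t (x - h - u) (- h) Ht ltac:(lra)). lra.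
Qed.

(* At variance [h^4] a shift by [h] amounts to [/ h] standard deviations. *)
Lemma smoothing_bias (x k : R) :
  filterlim (fun h => heat (h ^ 4 + 1) (x + k * h)) (at_right 0) (locally (Phi x)).
Proof.
  replace (Phi x) with (Phi ((x + k * 0) / sqrt (0 ^ 4 + 1))).
  2:{ f_equal. replace (0 ^ 4 + 1) with 1 by ring. rewrite sqrt_1. field. }
  apply (filterlim_filter_le_1 (F := locally 0) (fun h => heat (h ^ 4 + 1) (x + k * h))
           (filter_le_within _)).
  apply (continuous_comp (fun h => (x + k * h) / sqrt (h ^ 4 + 1)) Phi);
    [|apply continuous_Phi].
  apply (ex_derive_continuous (fun h => (x + k * h) / sqrt (h ^ 4 + 1))).
  auto_derive. replace (0 * (0 * (0 * (0 * 1))) + 1) with 1 by ring. rewrite sqrt_1. lra.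
Qed.

Lemma smoothing_tail :
  filterlim (fun h => heat (h ^ 4) (- h)) (at_right 0) (locally 0).
Proof.
  apply (filterlim_ext_loc (fun h => Phi (- / h))).
  - exists posreal_one. intros h _ Hh. unfold heat. f_equal.
    replace (h ^ 4) with ((h ^ 2) ^ 2) by ring. rewrite sqrt_pow2 by apply pow2_ge_0.
    field. lra.
  - apply (filterlim_comp _ _ _ (fun h => - / h) Phi _ (Rbar_locally m_infty));
      [|apply is_lim_Phi_m].
    apply (filterlim_comp _ _ _ Rinv Ropp _ (Rbar_locally p_infty));
      [apply filterlim_Rinv_0_right|apply (filterlim_Rbar_opp p_infty)].
Qed.

Lemma smoothing_parameters (x eps : R) : 0 < eps ->
  exists t h, 0 < t /\ heat (t + 1) (x + h) + heat t (- h) < Phi x + eps /\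
              Phi x - eps < heat (t + 1) (x - h) - heat t (- h).
Proof.
  intros Heps. assert (Heps2 : 0 < eps / 2) by lra.
  set (eps2 := mkposreal _ Heps2).
  assert (Tup := proj1 (filterlim_locally _ _) (smoothing_bias x 1) eps2).
  assert (Tlow := proj1 (filterlim_locally _ _) (smoothing_bias x (-1)) eps2).
  assert (Ttail := proj1 (filterlim_locally _ _) smoothing_tail eps2).
  assert (Tpos : at_right 0 (fun h => 0 < h)) by (exists posreal_one; now intros).
  destruct (filter_ex _ (filter_and _ _ Tpos (filter_and _ _ Ttail (filter_and _ _ Tup Tlow))))
    as (h & Hpos & Htail & Hup & Hlow).
  apply Rabs_lt_between' in Htail, Hup, Hlow. change (pos eps2) with (eps / 2) in *.
  replace (x + 1 * h) with (x + h) in Hup by ring.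
  replace (x + -1 * h) with (x - h) in Hlow by ring.
  exists (h ^ 4), h. split; [now apply pow_lt|lra].
Qed.

(** * Densities of sets of natural numbers *)

Definition count (p : nat -> bool) (N : nat) : nat := length (filter p (seq 0 N)).

(* Bounded discrepancy, not mere convergence: this is what interleaving preserves without any
   care for the lengths [N] that are not multiples of the period. *)
Definition has_density (p : nat -> bool) (m : R) : Prop :=
  exists C, forall N, Rabs (INR (count p N) - INR N * m) <= C.

Lemma count_succ (p : nat -> bool) (N : nat) :
  count p (S N) = (count p N + Nat.b2n (p N))%nat.
Proof.
  unfold count. rewrite seq_S, filter_app, length_app. simpl. now destruct (p N).
Qed.

Lemma count_add (p : nat -> bool) (M N : nat) :
  count p (M + N) = (count p M + count (fun n => p (M + n)%nat) N)%nat.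
Proof.
  induction N as [|N IH].
  - rewrite Nat.add_0_r. symmetry. apply Nat.add_0_r.
  - rewrite Nat.add_succ_r, !count_succ, IH. lia.
Qed.

Lemma count_le (p : nat -> bool) (N : nat) : (count p N <= N)%nat.
Proof.
  induction N as [|N IH]; [reflexivity|].
  rewrite count_succ. assert (H := Nat.b2n_le_1 (p N)). lia.
Qed.

Lemma count_const_on (p : nat -> bool) (a : bool) (N : nat) :
  (forall n, (n < N)%nat -> p n = a) -> count p N = (N * Nat.b2n a)%nat.
Proof.
  induction N as [|N IH]; intros Hp; [reflexivity|].
  rewrite count_succ, IH, Hp by auto with arith. lia.
Qed.

Lemma has_density_const_fun (p : nat -> bool) (a : bool) :
  (forall n, p n = a) -> has_density p (if a then 1 else 0).
Proof.
  intros Hp. exists 0. intros N. rewrite (count_const_on p a) by auto.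
  rewrite mult_INR, Rminus_diag_eq by (destruct a; reflexivity).
  rewrite Rabs_R0. apply Rle_refl.
Qed.

Lemma is_lim_seq_density (p : nat -> bool) (m : R) : has_density p m ->
  is_lim_seq (fun N => INR (count p N) / INR N) m.
Proof.
  intros [C HC].
  assert (Herr : is_lim_seq (fun N => (INR (count p N) - INR N * m) / INR N) 0).
  { apply is_lim_seq_abs_0.
    apply is_lim_seq_le_le_loc with (fun _ => 0) (fun N => C * / INR N).
    - exists 1%nat. intros N HN. apply lt_0_INR in HN.
      assert (HI := Rinv_0_lt_compat _ HN).
      split; [apply Rabs_pos|]. unfold Rdiv. rewrite Rabs_mult, (Rabs_right (/ INR N)) by lra.
      apply Rmult_le_compat_r; [lra|apply HC].
    - apply is_lim_seq_const.
    - replace (Finite 0) with (Rbar_mult C (Rbar_inv p_infty)) by (simpl; f_equal; ring).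
      apply is_lim_seq_scal_l, is_lim_seq_inv; [apply is_lim_seq_INR|discriminate]. }
  apply is_lim_seq_ext_loc with (fun N => m + (INR (count p N) - INR N * m) / INR N).
  - exists 1%nat. intros N HN. apply lt_0_INR in HN. field. lra.
  - replace (Finite m) with (Finite (m + 0)) by (f_equal; ring).
    apply is_lim_seq_plus'; [apply is_lim_seq_const|exact Herr].
Qed.

Lemma density_nonneg (p : nat -> bool) (m : R) : has_density p m -> 0 <= m.
Proof.
  intros Hp.
  apply (is_lim_seq_le_loc (fun _ => 0) (fun N => INR (count p N) / INR N) 0 m).
  - exists 1%nat. intros N HN. apply Rdiv_le_0_compat; [apply pos_INR|now apply lt_0_INR].
  - apply is_lim_seq_const.
  - now apply is_lim_seq_density.
Qed.

Section Interleaving.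

Variables (b k : nat) (p p1 p2 : nat -> bool) (m1 m2 : R).
Hypothesis Hb : (0 < b)%nat.
Hypothesis Hk : (k <= b)%nat.
Hypothesis Hp1 : forall n j, (j < k)%nat -> p (b * n + j)%nat = p1 n.
Hypothesis Hp2 : forall n j, (k <= j < b)%nat -> p (b * n + j)%nat = p2 n.

Lemma count_interleave (N : nat) :
  count p (b * N) = (k * count p1 N + (b - k) * count p2 N)%nat.
Proof.
  induction N as [|N IH].
  - rewrite Nat.mul_0_r. unfold count. simpl. lia.
  - replace (b * S N)%nat with (b * N + k + (b - k))%nat by lia.
    rewrite !count_add, IH, !count_succ.
    rewrite (count_const_on _ (p1 N) k) by auto.
    rewrite (count_const_on _ (p2 N) (b - k)).
    + lia.
    + intros n Hn. rewrite <- Nat.add_assoc. apply Hp2. lia.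
Qed.

Lemma has_density_interleave : has_density p1 m1 -> has_density p2 m2 ->
  has_density p (INR k / INR b * m1 + INR (b - k) / INR b * m2).
Proof.
  intros [C1 Hdens1] [C2 Hdens2].
  set (m := INR k / INR b * m1 + INR (b - k) / INR b * m2).
  assert (Hb0 : 0 < INR b) by now apply lt_0_INR.
  exists (INR k * C1 + INR (b - k) * C2 + INR b + INR b * Rabs m). intros N.
  rewrite (Nat.div_mod_eq N b). set (q := (N / b)%nat). set (j := (N mod b)%nat).
  rewrite count_add, count_interleave, !plus_INR, !mult_INR.
  set (rest := count _ j).
  replace (INR k * INR (count p1 q) + INR (b - k) * INR (count p2 q) + INR rest
           - (INR b * INR q + INR j) * m)
    with (INR k * (INR (count p1 q) - INR q * m1)
          + INR (b - k) * (INR (count p2 q) - INR q * m2) + INR rest + - (INR j * m))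
    by (unfold m; field; lra).
  assert (Hjb : INR j <= INR b) by (apply le_INR, Nat.lt_le_incl, Nat.mod_upper_bound; lia).
  assert (Hrest : INR rest <= INR j) by apply le_INR, count_le.
  assert (Pk := pos_INR k). assert (Pbk := pos_INR (b - k)).
  assert (Prest := pos_INR rest).
  repeat (eapply Rle_trans; [apply Rabs_triang|]; apply Rplus_le_compat).
  - rewrite Rabs_mult, (Rabs_right (INR k)) by lra. now apply Rmult_le_compat_l.
  - rewrite Rabs_mult, (Rabs_right (INR (b - k))) by lra. now apply Rmult_le_compat_l.
  - rewrite Rabs_right; lra.
  - rewrite Rabs_Ropp, Rabs_mult, (Rabs_right (INR j)) by lra.
    apply Rmult_le_compat_r; [apply Rabs_pos|exact Hjb].
Qed.

End Interleaving.

(** * Sums over the integers *)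

Lemma Series_le_compat (u v : nat -> R) : (forall n, u n <= v n) ->
  ex_series u -> ex_series v -> Series u <= Series v.
Proof.
  intros Huv Eu Ev.
  apply (is_lim_seq_le (sum_n u) (sum_n v) (Series u) (Series v)).
  - intros n. now apply sum_n_m_le.
  - now apply Series_correct.
  - now apply Series_correct.
Qed.

Lemma CV_radius_succ_pow (n : nat) : CV_radius (fun k => INR (S k) ^ n) = 1.
Proof.
  induction n as [|n IH].
  - rewrite (CV_radius_finite_DAlembert _ 1); [f_equal; apply Rinv_1|intros; simpl; lra|lra|].
    apply is_lim_seq_ext with (fun _ => 1); [|apply is_lim_seq_const].
    intros k. simpl. unfold Rdiv. rewrite Rinv_1, Rmult_1_r. symmetry. apply Rabs_R1.
  - etransitivity; [apply (CV_radius_derive (PS_incr_1 (fun k => INR (S k) ^ n)))|].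
    now rewrite CV_radius_incr_1.
Qed.

Lemma ex_series_succ_pow_geom (n : nat) (q : R) : 0 < q < 1 ->
  ex_series (fun k => INR (S k) ^ n * q ^ k).
Proof.
  intros Hq. apply ex_series_Rabs, (CV_disk_inside (fun k => INR (S k) ^ n)).
  rewrite CV_radius_succ_pow, Rabs_right by lra. simpl. lra.
Qed.

Definition zsummable (f : Z -> R) : Prop :=
  ex_series (fun k => f (Z.of_nat k)) /\ ex_series (fun k => f (- Z.of_nat (S k))%Z).

Lemma zsum_ext (f g : Z -> R) : (forall d, f d = g d) -> zsum f = zsum g.
Proof. intros H. unfold zsum. f_equal; apply Series_ext; intros; apply H. Qed.

Lemma zsummable_ext (f g : Z -> R) : (forall d, f d = g d) -> zsummable f -> zsummable g.
Proof.
  intros H [Fpos Fneg]. split; [apply (ex_series_ext _ _ (fun k => H _) Fpos)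
                           |apply (ex_series_ext _ _ (fun k => H _) Fneg)].
Qed.

Lemma zsummable_dominated (f : Z -> R) (u : nat -> R) :
  (forall d, Rabs (f d) <= u (Z.abs_nat d)) -> ex_series u -> zsummable f.
Proof.
  intros Hf Eu. split.
  - apply (ex_series_le (V := R_CompleteNormedModule)) with u; [|exact Eu].
    intros k. rewrite <- (Zabs2Nat.id k) at 2. apply Hf.
  - apply (ex_series_le (V := R_CompleteNormedModule)) with (fun k => u (S k)).
    + intros k. replace (S k) with (Z.abs_nat (- Z.of_nat (S k))) at 2 by lia. apply Hf.
    + now apply (ex_series_incr_1 u).
Qed.

Lemma zsum_plus (f g : Z -> R) : zsummable f -> zsummable g ->
  zsum (fun d => f d + g d) = zsum f + zsum g.
Proof.
  intros [Fpos Fneg] [Gpos Gneg]. unfold zsum.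
  rewrite (Series_plus (fun k => f (Z.of_nat k))) by assumption.
  rewrite (Series_plus (fun k => f (- Z.of_nat (S k))%Z)) by assumption.
  ring.
Qed.

Lemma zsummable_scal (a : R) (f : Z -> R) : zsummable f -> zsummable (fun d => a * f d).
Proof. intros [Fpos Fneg]. split; now apply (ex_series_scal (V := R_NormedModule)). Qed.

Lemma zsum_scal (a : R) (f : Z -> R) : zsum (fun d => a * f d) = a * zsum f.
Proof. unfold zsum. rewrite !Series_scal_l. ring. Qed.

Lemma zsum_le (f g : Z -> R) : zsummable f -> zsummable g -> (forall d, f d <= g d) ->
  zsum f <= zsum g.
Proof.
  intros [Fpos Fneg] [Gpos Gneg] H. apply Rplus_le_compat; now apply Series_le_compat.
Qed.

Lemma zsum_supported_at_0 (f : Z -> R) : (forall d, d <> 0%Z -> f d = 0) -> zsum f = f 0%Z.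
Proof.
  intros Hf. unfold zsum.
  rewrite (Series_ext _ (fun k => f 0%Z * 0 ^ k)).
  - rewrite Series_scal_l, Series_geom by (rewrite Rabs_R0; lra).
    rewrite (Series_ext _ (fun _ => 0 * 0)); [rewrite Series_scal_l; field|].
    intros k. rewrite Hf by lia. ring.
  - intros [|k]; [simpl; ring|]. rewrite pow_ne_zero, Hf by lia. ring.
Qed.

Lemma zsum_succ (f : Z -> R) : zsummable f ->
  zsummable (fun d => f (d + 1)%Z) /\ zsum (fun d => f (d + 1)%Z) = zsum f.
Proof.
  intros [Fpos Fneg].
  assert (Epos : forall k, f (Z.of_nat (S k)) = f (Z.of_nat k + 1)%Z)
    by (intros; f_equal; lia).
  assert (Eneg : forall k, f (- Z.of_nat (S k))%Z = f (- Z.of_nat (S (S k)) + 1)%Z)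
    by (intros; f_equal; lia).
  assert (Gpos : ex_series (fun k => f (Z.of_nat k + 1)%Z)).
  { apply (ex_series_ext _ _ Epos), (ex_series_incr_1 (fun k => f (Z.of_nat k))), Fpos. }
  assert (Gneg : ex_series (fun k => f (- Z.of_nat (S k) + 1)%Z)).
  { apply (ex_series_incr_1 (fun k => f (- Z.of_nat (S k) + 1)%Z)).
    apply (ex_series_ext _ _ Eneg), Fneg. }
  split; [now split|]. unfold zsum.
  rewrite (Series_incr_1 (fun k => f (Z.of_nat k))) by exact Fpos.
  rewrite (Series_incr_1 (fun k => f (- Z.of_nat (S k) + 1)%Z)) by exact Gneg.
  rewrite (Series_ext _ _ Epos), (Series_ext _ _ Eneg).
  change (- Z.of_nat 1 + 1)%Z with (Z.of_nat 0). ring.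
Qed.

Lemma zsum_shift_nat (c : nat) (f : Z -> R) : zsummable f ->
  zsum (fun d => f (d + Z.of_nat c)%Z) = zsum f.
Proof.
  revert f. induction c as [|c IH]; intros f Hf.
  - apply zsum_ext. intros d. f_equal. lia.
  - destruct (zsum_succ f Hf) as [Hsucc <-]. rewrite <- (IH _ Hsucc).
    apply zsum_ext. intros d. f_equal. lia.
Qed.

Lemma zsum_shift (c : Z) (f : Z -> R) : zsummable f -> zsummable (fun d => f (d + c)%Z) ->
  zsum (fun d => f (d + c)%Z) = zsum f.
Proof.
  intros Hf Hg. destruct (Z_le_dec 0 c) as [Hc|Hc].
  - rewrite <- (zsum_shift_nat (Z.to_nat c) f Hf). apply zsum_ext. intros d. f_equal. lia.
  - rewrite <- (zsum_shift_nat (Z.to_nat (- c)) _ Hg). apply zsum_ext. intros d. f_equal. lia.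
Qed.

(** * Functions of polynomial growth and of exponential decay *)

Definition tempered (F : Z -> R) : Prop :=
  exists K n, 0 <= K /\ forall d, Rabs (F d) <= K * INR (S (Z.abs_nat d)) ^ n.

Definition decays (q : R) (f : Z -> R) : Prop :=
  exists K, 0 <= K /\ forall d, Rabs (f d) <= K * q ^ Z.abs_nat d.

Lemma tempered_bounded (F : Z -> R) (K : R) : (forall d, Rabs (F d) <= K) -> tempered F.
Proof.
  intros HF. exists K, 0%nat. split.
  - eapply Rle_trans; [apply Rabs_pos|apply (HF 0%Z)].
  - intros d. rewrite pow_O, Rmult_1_r. apply HF.
Qed.

Lemma tempered_const (k : R) : tempered (fun _ => k).
Proof. apply (tempered_bounded _ (Rabs k)). intros _. apply Rle_refl. Qed.

Lemma tempered_IZR : tempered IZR.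
Proof.
  exists 1, 1%nat. split; [lra|]. intros d.
  rewrite <- abs_IZR, <- Zabs2Nat.id_abs, <- INR_IZR_INZ, pow_1, S_INR. lra.
Qed.

Lemma tempered_plus (F G : Z -> R) : tempered F -> tempered G -> tempered (fun d => F d + G d).
Proof.
  intros (K1 & n1 & HK1 & HF) (K2 & n2 & HK2 & HG).
  exists (K1 + K2), (n1 + n2)%nat. split; [lra|]. intros d.
  assert (H : 1 <= INR (S (Z.abs_nat d))) by (apply (le_INR 1); lia).
  eapply Rle_trans; [apply Rabs_triang|]. rewrite Rmult_plus_distr_r. apply Rplus_le_compat.
  - eapply Rle_trans; [apply HF|]. apply Rmult_le_compat_l; [exact HK1|].
    apply Rle_pow; [exact H|lia].
  - eapply Rle_trans; [apply HG|]. apply Rmult_le_compat_l; [exact HK2|].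
    apply Rle_pow; [exact H|lia].
Qed.

Lemma tempered_mult (F G : Z -> R) : tempered F -> tempered G -> tempered (fun d => F d * G d).
Proof.
  intros (K1 & n1 & HK1 & HF) (K2 & n2 & HK2 & HG).
  exists (K1 * K2), (n1 + n2)%nat. split; [now apply Rmult_le_pos|]. intros d.
  rewrite Rabs_mult, pow_add.
  replace (K1 * K2 * _) with (K1 * INR (S (Z.abs_nat d)) ^ n1 * (K2 * INR (S (Z.abs_nat d)) ^ n2))
    by ring.
  apply Rmult_le_compat; auto using Rabs_pos.
Qed.

Lemma tempered_sqr : tempered (fun d => IZR d ^ 2).
Proof.
  apply (tempered_mult IZR (fun d => IZR d * 1)); [apply tempered_IZR|].
  apply (tempered_mult IZR (fun _ => 1)); [apply tempered_IZR|apply tempered_const].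
Qed.

Lemma tempered_shift (c : Z) (F : Z -> R) : tempered F -> tempered (fun d => F (d + c)%Z).
Proof.
  intros (K & n & HK & H).
  exists (K * INR (S (Z.abs_nat c)) ^ n), n. split.
  - apply Rmult_le_pos; [exact HK|apply pow_le, pos_INR].
  - intros d. eapply Rle_trans; [apply H|]. rewrite Rmult_assoc, <- Rpow_mult_distr, <- mult_INR.
    apply Rmult_le_compat_l; [exact HK|]. apply pow_incr. split; [apply pos_INR|].
    apply le_INR. nia.
Qed.

Lemma pow_le_antitone (q : R) (m n : nat) : 0 < q <= 1 -> (m <= n)%nat -> q ^ n <= q ^ m.
Proof.
  intros Hq Hmn. replace n with (m + (n - m))%nat by lia.
  assert (Hrest : q ^ (n - m) <= 1 ^ (n - m)) by (apply pow_incr; lra).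
  assert (Hm : 0 < q ^ m) by (apply pow_lt; lra).
  rewrite pow_add. rewrite pow1 in Hrest. nra.
Qed.

Lemma bernoulli (x : R) (n : nat) : -1 <= x -> 1 + INR n * x <= (1 + x) ^ n.
Proof.
  intros Hx. induction n as [|n IH]; [simpl; lra|].
  rewrite S_INR. simpl pow. assert (Hn := pos_INR n).
  apply Rmult_le_compat_l with (r := 1 + x) in IH; [|lra].
  assert (0 <= INR n * x ^ 2) by (apply Rmult_le_pos; [exact Hn|apply pow2_ge_0]). lra.
Qed.

Lemma decays_shift (q : R) (c : Z) (f : Z -> R) : 0 < q <= 1 -> decays q f ->
  decays q (fun d => f (d + c)%Z).
Proof.
  intros Hq (K & HK & Hf). assert (Hqc : 0 < q ^ Z.abs_nat c) by (apply pow_lt; lra).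
  exists (K * / q ^ Z.abs_nat c). split.
  - apply Rmult_le_pos; [exact HK|]. now apply Rlt_le, Rinv_0_lt_compat.
  - intros d. eapply Rle_trans; [apply Hf|]. rewrite Rmult_assoc.
    apply Rmult_le_compat_l; [exact HK|].
    apply Rmult_le_reg_l with (q ^ Z.abs_nat c); [exact Hqc|].
    rewrite <- Rmult_assoc, Rinv_r, Rmult_1_l, <- pow_add by lra.
    apply pow_le_antitone; [exact Hq|lia].
Qed.

Lemma decays_linear_combination (q a1 a2 : R) (f g : Z -> R) : decays q f -> decays q g ->
  decays q (fun d => a1 * f d + a2 * g d).
Proof.
  intros (K1 & HK1 & Hf) (K2 & HK2 & Hg). exists (Rabs a1 * K1 + Rabs a2 * K2). split.
  - apply Rplus_le_le_0_compat; apply Rmult_le_pos; auto using Rabs_pos.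
  - intros d. eapply Rle_trans; [apply Rabs_triang|].
    rewrite !Rabs_mult, Rmult_plus_distr_r, !Rmult_assoc.
    apply Rplus_le_compat; apply Rmult_le_compat_l; auto using Rabs_pos.
Qed.

Lemma zsummable_tempered_decays (q : R) (F f : Z -> R) : 0 < q < 1 ->
  tempered F -> decays q f -> zsummable (fun d => F d * f d).
Proof.
  intros Hq (K1 & n & HK1 & HF) (K2 & HK2 & Hf).
  apply (zsummable_dominated _ (fun k => K1 * K2 * (INR (S k) ^ n * q ^ k))).
  - intros d. rewrite Rabs_mult.
    replace (K1 * K2 * _) with (K1 * INR (S (Z.abs_nat d)) ^ n * (K2 * q ^ Z.abs_nat d)) by ring.
    apply Rmult_le_compat; auto using Rabs_pos.
  - now apply (ex_series_scal (V := R_NormedModule)), ex_series_succ_pow_geom.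
Qed.

(** * The digit recursion *)

Section Base.

Variable b : nat.
Hypothesis Hb : (2 <= b)%nat.

Lemma INR_base_ge_2 : 2 <= INR b.
Proof. apply (le_INR 2), Hb. Qed.

(* The digit [c] of [b * r + c] produces a carry with probability [c / b]. *)
Definition carry_mean (c : nat) (x y : R) : R := INR (b - c) / INR b * x + INR c / INR b * y.

Lemma carry_mean_le (c : nat) (x y x' y' : R) :
  x <= x' -> y <= y' -> carry_mean c x y <= carry_mean c x' y'.
Proof.
  intros Hx Hy. assert (HB := INR_base_ge_2).
  apply Rplus_le_compat; (apply Rmult_le_compat_l; [|assumption]);
    (apply Rdiv_le_0_compat; [apply pos_INR|lra]).
Qed.

Lemma carry_mean_diag (c : nat) (x : R) : (c <= b)%nat -> carry_mean c x x = x.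
Proof.
  intros Hc. assert (HB := INR_base_ge_2). unfold carry_mean.
  rewrite minus_INR by exact Hc. field. lra.
Qed.

Lemma carry_mean_0 (x y : R) : carry_mean 0 x y = x.
Proof.
  assert (HB := INR_base_ge_2). unfold carry_mean. rewrite Nat.sub_0_r. simpl. field. lra.
Qed.

Lemma base_ind (P : nat -> Prop) : P 0%nat ->
  (forall n m, (m < b)%nat -> P n -> P (b * n + m)%nat) -> forall n, P n.
Proof.
  intros P0 Pstep n. induction n as [n IH] using lt_wf_ind.
  destruct (Nat.eq_dec n 0) as [->|Hn]; [exact P0|].
  rewrite (Nat.div_mod_eq n b). apply Pstep.
  - apply Nat.mod_upper_bound. lia.
  - apply IH, Nat.div_lt; lia.
Qed.

Lemma base_carry_ind (P : nat -> Prop) : P 0%nat -> P 1%nat ->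
  (forall r, P r -> P (b * r)%nat) ->
  (forall r c, (0 < c < b)%nat -> P r -> P (S r) -> P (b * r + c)%nat) ->
  forall r, P r.
Proof.
  intros P0 P1 Pmul Pmix r. induction r as [r IH] using lt_wf_ind.
  destruct (le_lt_dec r 1) as [Hr|Hr].
  - destruct r as [|[|r]]; [exact P0|exact P1|lia].
  - assert (Hc : (r mod b < b)%nat) by (apply Nat.mod_upper_bound; lia).
    assert (E := Nat.div_mod_eq r b). rewrite E.
    destruct (Nat.eq_dec (r mod b) 0) as [Hdigit|Hdigit].
    + rewrite Hdigit, Nat.add_0_r in *. apply Pmul, IH. nia.
    + apply Pmix; [lia|apply IH; nia|].
      destruct (Nat.eq_dec (r / b) 0) as [->|Hquot]; [exact P1|apply IH; nia].
Qed.

Lemma carry_subharmonic_le_at_0 (u : nat -> R) :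
  (forall r c, (c < b)%nat -> u (b * r + c)%nat <= carry_mean c (u r) (u (S r))) ->
  forall r, u r <= u 0%nat.
Proof.
  intros Hu r. assert (HB := INR_base_ge_2).
  induction r as [| |r IH|r c Hc IH1 IH2] using base_carry_ind.
  - apply Rle_refl.
  - assert (H := Hu 0%nat 1%nat ltac:(lia)). rewrite Nat.mul_0_r in H. simpl in H.
    unfold carry_mean in H. rewrite minus_INR in H by lia. simpl INR in H.
    apply Rmult_le_compat_r with (r := INR b) in H; [|lra].
    replace (((INR b - 1) / INR b * u 0%nat + 1 / INR b * u 1%nat) * INR b)
      with ((INR b - 1) * u 0%nat + u 1%nat) in H by (field; lra).
    apply Rmult_le_reg_r with (INR b - 1); lra.
  - assert (H := Hu r 0%nat ltac:(lia)). rewrite Nat.add_0_r, carry_mean_0 in H. lra.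
  - eapply Rle_trans; [apply Hu; lia|].
    rewrite <- (carry_mean_diag c (u 0%nat)) by lia. now apply carry_mean_le.
Qed.

Lemma carry_harmonic_eq_at_0 (u : nat -> R) :
  (forall r c, (c < b)%nat -> u (b * r + c)%nat = carry_mean c (u r) (u (S r))) ->
  forall r, u r = u 0%nat.
Proof.
  intros Hu r. apply Rle_antisym.
  - apply carry_subharmonic_le_at_0. intros q c Hc. now apply Req_le, Hu.
  - apply Ropp_le_cancel, (carry_subharmonic_le_at_0 (fun q => - u q)).
    intros q c Hc. rewrite Hu by exact Hc. unfold carry_mean. lra.
Qed.

Lemma div_mul_add (n m : nat) : (m < b)%nat -> ((b * n + m) / b)%nat = n.
Proof. intros Hm. symmetry. now apply Nat.div_unique with m. Qed.

Lemma digit_mul_add_0 (n m : nat) : (m < b)%nat -> digit b (b * n + m) 0 = m.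
Proof.
  intros Hm. unfold digit. rewrite Nat.pow_0_r, Nat.div_1_r.
  symmetry. now apply Nat.mod_unique with n.
Qed.

Lemma digit_succ (n k : nat) : digit b n (S k) = digit b (n / b) k.
Proof. unfold digit. now rewrite Nat.pow_succ_r', Nat.Div0.div_div. Qed.

Lemma digit_lt (n k : nat) : (digit b n k < b)%nat.
Proof. apply Nat.mod_upper_bound. lia. Qed.

Lemma div_pow_digit (n k : nat) : (n / b ^ k = b * (n / b ^ S k) + digit b n k)%nat.
Proof.
  unfold digit. rewrite Nat.pow_succ_r', (Nat.mul_comm b (b ^ k)), <- Nat.Div0.div_div.
  apply Nat.div_mod_eq.
Qed.

Definition low_digsum (n L : nat) : nat := fold_right Nat.add 0%nat (map (digit b n) (seq 0 L)).

Lemma low_digsum_succ (n L : nat) :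
  low_digsum n (S L) = (digit b n 0 + low_digsum (n / b) L)%nat.
Proof.
  unfold low_digsum. cbn [seq map fold_right]. f_equal.
  rewrite <- seq_shift, map_map. f_equal. apply map_ext, digit_succ.
Qed.

Lemma low_digsum_0 (L : nat) : low_digsum 0 L = 0%nat.
Proof.
  induction L as [|L IH]; [reflexivity|].
  rewrite low_digsum_succ, Nat.Div0.div_0_l, IH.
  unfold digit. now rewrite Nat.Div0.div_0_l, Nat.Div0.mod_0_l.
Qed.

Lemma low_digsum_stable (L L' n : nat) : (n < L)%nat -> (n < L')%nat ->
  low_digsum n L = low_digsum n L'.
Proof.
  revert L' n. induction L as [|L IH]; intros [|L'] n HL HL'; try lia.
  destruct (Nat.eq_dec n 0) as [->|Hn].
  - now rewrite !low_digsum_0.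
  - rewrite !low_digsum_succ. f_equal.
    assert (n / b < n)%nat by (apply Nat.div_lt; lia). apply IH; lia.
Qed.

Lemma digsum_mul_add (n m : nat) : (m < b)%nat -> digsum b (b * n + m) = (digsum b n + m)%nat.
Proof.
  intros Hm. change (low_digsum (b * n + m) (S (b * n + m)) = low_digsum n (S n) + m)%nat.
  rewrite low_digsum_succ, digit_mul_add_0, div_mul_add, Nat.add_comm by exact Hm. f_equal.
  destruct (Nat.eq_dec n 0) as [->|Hn].
  - now rewrite !low_digsum_0.
  - apply low_digsum_stable; nia.
Qed.

Lemma Delta_no_carry (r c n m : nat) : (m + c < b)%nat ->
  Defs.Delta b (b * r + c) (b * n + m) = (Defs.Delta b r n + Z.of_nat c)%Z.
Proof.
  intros H. unfold Defs.Delta.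
  replace (b * n + m + (b * r + c))%nat with (b * (n + r) + (m + c))%nat by lia.
  rewrite !digsum_mul_add by lia. lia.
Qed.

Lemma Delta_carry (r c n m : nat) : (m < b)%nat -> (c < b)%nat -> (b <= m + c)%nat ->
  Defs.Delta b (b * r + c) (b * n + m) = (Defs.Delta b (S r) n + Z.of_nat c - Z.of_nat b)%Z.
Proof.
  intros Hm Hc H. unfold Defs.Delta.
  replace (b * n + m + (b * r + c))%nat with (b * (n + S r) + (m + c - b))%nat by lia.
  rewrite !digsum_mul_add by lia. lia.
Qed.

Lemma Delta_0 (n : nat) : Defs.Delta b 0 n = 0%Z.
Proof. unfold Defs.Delta. rewrite Nat.add_0_r. lia. Qed.

Lemma Delta_1_le (n : nat) : (Defs.Delta b 1 n <= 1)%Z.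
Proof.
  induction n as [|n m Hm IH] using base_ind.
  - assert (H := Delta_no_carry 0 1 0 0 ltac:(lia)).
    rewrite Delta_0, !Nat.mul_0_r in H. simpl in H. lia.
  - replace 1%nat with (b * 0 + 1)%nat by lia.
    destruct (le_lt_dec b (m + 1)) as [H|H].
    + rewrite Delta_carry by lia. lia.
    + rewrite Delta_no_carry, Delta_0 by lia. reflexivity.
Qed.

(** * The measures mu *)

Definition hits (r : nat) (d : Z) (n : nat) : bool := Z.eqb (Defs.Delta b r n) d.

Lemma mu_eq_density (r : nat) (d : Z) (m : R) : has_density (hits r d) m -> mu b r d = m.
Proof.
  intros H. change (real (Lim_seq (fun N => INR (count (hits r d) N) / INR N)) = m).
  now rewrite (is_lim_seq_unique _ _ (is_lim_seq_density _ _ H)).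
Qed.

Lemma density_mix (r c : nat) (d : Z) (m1 m2 : R) : (c < b)%nat ->
  has_density (hits r (d - Z.of_nat c)) m1 ->
  has_density (hits (S r) (d - Z.of_nat c + Z.of_nat b)) m2 ->
  has_density (hits (b * r + c) d) (carry_mean c m1 m2).
Proof.
  intros Hc Hno_carry Hcarry. unfold carry_mean.
  replace (INR c) with (INR (b - (b - c))) by (f_equal; lia).
  refine (has_density_interleave b (b - c) _ _ _ m1 m2 _ _ _ _ Hno_carry Hcarry); [lia|lia| |];
    intros n j Hj; apply Bool.eq_iff_eq_true; unfold hits; rewrite !Z.eqb_eq.
  - rewrite Delta_no_carry by lia. lia.
  - rewrite Delta_carry by lia. lia.
Qed.

Lemma density_mul (r : nat) (d : Z) (m : R) :
  has_density (hits r d) m -> has_density (hits (b * r) d) m.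
Proof.
  intros H. replace m with (INR b / INR b * m + INR (b - b) / INR b * 0)
    by (field; generalize INR_base_ge_2; lra).
  apply (has_density_interleave b b _ (hits r d) (fun _ => false)); [lia|lia| |lia|exact H|].
  - intros n j Hj. unfold hits. rewrite <- (Nat.add_0_r (b * r)), Delta_no_carry by lia.
    now rewrite Z.add_0_r.
  - now apply (has_density_const_fun _ false).
Qed.

Lemma density_0 (d : Z) : has_density (hits 0 d) (if Z.eqb 0 d then 1 else 0).
Proof. apply has_density_const_fun. intros n. unfold hits. now rewrite Delta_0. Qed.

Lemma density_1_above (d : Z) : (1 < d)%Z -> has_density (hits 1 d) 0.
Proof.
  intros Hd. apply (has_density_const_fun _ false). intros n. apply Z.eqb_neq.
  assert (H := Delta_1_le n). lia.
Qed.

(* The recursion expresses the density at [d] through the one at [d + (b - 1)]. *)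
Lemma density_1_exists (d : Z) : exists m, has_density (hits 1 d) m.
Proof.
  assert (H : forall k e, (2 - Z.of_nat k <= e)%Z -> exists m, has_density (hits 1 e) m).
  { induction k as [|k IH]; intros e He.
    - exists 0. apply density_1_above. lia.
    - destruct (IH (e - Z.of_nat 1 + Z.of_nat b)%Z) as [m Hm]; [lia|].
      eexists. replace 1%nat with (b * 0 + 1)%nat by lia.
      apply density_mix; [lia|apply density_0|exact Hm]. }
  apply (H (Z.to_nat (2 - d))). lia.
Qed.

Lemma density_exists (r : nat) : forall d, exists m, has_density (hits r d) m.
Proof.
  induction r as [| |r IH|r c Hc IH1 IH2] using base_carry_ind; intros d.
  - eexists. apply density_0.
  - apply density_1_exists.
  - destruct (IH d) as [m Hm]. exists m. now apply density_mul.
  - destruct (IH1 (d - Z.of_nat c)%Z) as [m1 Hm1].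
    destruct (IH2 (d - Z.of_nat c + Z.of_nat b)%Z) as [m2 Hm2].
    eexists. apply density_mix; [lia|exact Hm1|exact Hm2].
Qed.

Lemma density_mu (r : nat) (d : Z) : has_density (hits r d) (mu b r d).
Proof. destruct (density_exists r d) as [m Hm]. now rewrite (mu_eq_density _ _ _ Hm). Qed.

Lemma mu_nonneg (r : nat) (d : Z) : 0 <= mu b r d.
Proof. apply (density_nonneg (hits r d)), density_mu. Qed.

Lemma mu_mix (r c : nat) (d : Z) : (c < b)%nat ->
  mu b (b * r + c) d =
  carry_mean c (mu b r (d - Z.of_nat c)) (mu b (S r) (d - Z.of_nat c + Z.of_nat b)).
Proof. intros Hc. apply mu_eq_density, density_mix; [exact Hc|apply density_mu..]. Qed.

Lemma mu_mul (r : nat) (d : Z) : mu b (b * r) d = mu b r d.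
Proof. apply mu_eq_density, density_mul, density_mu. Qed.

Lemma mu_0 (d : Z) : mu b 0 d = if Z.eqb 0 d then 1 else 0.
Proof. apply mu_eq_density, density_0. Qed.

Lemma mu_1_above (d : Z) : (1 < d)%Z -> mu b 1 d = 0.
Proof. intros Hd. now apply mu_eq_density, density_1_above. Qed.

(** * Expectation with respect to mu *)

Definition ratio : R := 1 - / INR b.

Lemma inv_base_bounds : 0 < / INR b <= / 2.
Proof.
  assert (HB := INR_base_ge_2). split; [apply Rinv_0_lt_compat; lra|].
  apply Rinv_le_contravar; lra.
Qed.

Lemma ratio_bounds : 0 < ratio < 1.
Proof. unfold ratio. generalize inv_base_bounds. lra. Qed.

Lemma inv_base_le_ratio_pow : / INR b <= ratio ^ (b - 1).
Proof.
  assert (HI := inv_base_bounds). assert (HB := INR_base_ge_2).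
  assert (H := bernoulli (- / INR b) (b - 1) ltac:(lra)).
  rewrite minus_INR in H by lia.
  replace (1 + (INR b - INR 1) * - / INR b) with (/ INR b) in H by (simpl; field; lra).
  exact H.
Qed.

Lemma mu_1_mix (d : Z) :
  mu b 1 d = ratio * mu b 0 (d - 1) + / INR b * mu b 1 (d - 1 + Z.of_nat b).
Proof.
  assert (HB := INR_base_ge_2). assert (H := mu_mix 0 1 d ltac:(lia)).
  replace (b * 0 + 1)%nat with 1%nat in H by lia. rewrite H. unfold carry_mean, ratio.
  rewrite minus_INR by lia. simpl. field. lra.
Qed.

Lemma mu_1_le (k : nat) : mu b 1 (1 - Z.of_nat k) <= ratio ^ k.
Proof.
  assert (HQ := ratio_bounds). assert (HI := inv_base_bounds).
  induction k as [k IH] using lt_wf_ind.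
  rewrite mu_1_mix, mu_0.
  destruct (Z.eqb_spec 0 (1 - Z.of_nat k - 1)) as [E|E].
  - rewrite mu_1_above by lia. replace k with 0%nat by lia. simpl. lra.
  - rewrite Rmult_0_r, Rplus_0_l. destruct (le_lt_dec (b - 1) k) as [H|H].
    + replace (1 - Z.of_nat k - 1 + Z.of_nat b)%Z with (1 - Z.of_nat (k - (b - 1)))%Z by lia.
      replace k with ((b - 1) + (k - (b - 1)))%nat at 2 by lia. rewrite pow_add.
      apply Rmult_le_compat; [lra|apply mu_nonneg|apply inv_base_le_ratio_pow|apply IH; lia].
    + rewrite mu_1_above, Rmult_0_r by lia. apply pow_le. lra.
Qed.

Lemma decays_mu_0 : decays ratio (mu b 0).
Proof.
  assert (HQ := ratio_bounds). exists 1. split; [lra|]. intros d.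
  rewrite mu_0. destruct (Z.eqb_spec 0 d) as [<-|].
  - simpl. rewrite Rabs_R1. lra.
  - rewrite Rabs_R0, Rmult_1_l. apply pow_le. lra.
Qed.

Lemma decays_mu_1 : decays ratio (mu b 1).
Proof.
  assert (HQ := ratio_bounds). assert (HI : 1 < / ratio).
  { rewrite <- Rinv_1. apply Rinv_lt_contravar; lra. }
  exists (/ ratio). split; [lra|]. intros d.
  rewrite Rabs_right by apply Rle_ge, mu_nonneg.
  destruct (Z_le_dec d 1) as [H|H].
  - replace d with (1 - Z.of_nat (Z.to_nat (1 - d)))%Z at 1 by lia.
    eapply Rle_trans; [apply mu_1_le|].
    apply Rmult_le_reg_l with ratio; [lra|].
    rewrite <- Rmult_assoc, Rinv_r, Rmult_1_l, tech_pow_Rmult by lra.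
    apply pow_le_antitone; [lra|lia].
  - rewrite mu_1_above by lia. apply Rmult_le_pos; [lra|apply pow_le; lra].
Qed.

Lemma decays_mu (r : nat) : decays ratio (mu b r).
Proof.
  assert (HQ := ratio_bounds).
  induction r as [| |r [K HK]|r c Hc IH1 IH2] using base_carry_ind.
  - apply decays_mu_0.
  - apply decays_mu_1.
  - exists K. now setoid_rewrite mu_mul.
  - destruct (decays_linear_combination ratio (INR (b - c) / INR b) (INR c / INR b)
                (fun d => mu b r (d + - Z.of_nat c))
                (fun d => mu b (S r) (d + (- Z.of_nat c + Z.of_nat b))))
      as [K [PK HK]]; [apply decays_shift; [lra|assumption]..|].
    exists K. split; [exact PK|]. intros d. rewrite mu_mix by lia. unfold carry_mean.
    replace (d - Z.of_nat c + Z.of_nat b)%Z with (d + (- Z.of_nat c + Z.of_nat b))%Z by lia.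
    apply HK.
Qed.

Definition expect (r : nat) (F : Z -> R) : R := zsum (fun d => F d * mu b r d).

Lemma zsummable_expect (r : nat) (F : Z -> R) :
  tempered F -> zsummable (fun d => F d * mu b r d).
Proof.
  intros HF. apply (zsummable_tempered_decays ratio);
    [apply ratio_bounds|exact HF|apply decays_mu].
Qed.

Lemma expect_ext (r : nat) (F G : Z -> R) : (forall d, F d = G d) -> expect r F = expect r G.
Proof. intros H. apply zsum_ext. intros d. now rewrite H. Qed.

Lemma expect_plus (r : nat) (F G : Z -> R) : tempered F -> tempered G ->
  expect r (fun d => F d + G d) = expect r F + expect r G.
Proof.
  intros HF HG. unfold expect. rewrite <- zsum_plus by now apply zsummable_expect.
  apply zsum_ext. intros d. ring.
Qed.

Lemma expect_scal (r : nat) (a : R) (F : Z -> R) :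
  expect r (fun d => a * F d) = a * expect r F.
Proof. unfold expect. rewrite <- zsum_scal. apply zsum_ext. intros d. ring. Qed.

Lemma expect_le (r : nat) (F G : Z -> R) : tempered F -> tempered G ->
  (forall d, F d <= G d) -> expect r F <= expect r G.
Proof.
  intros HF HG H. apply zsum_le; [now apply zsummable_expect..|].
  intros d. apply Rmult_le_compat_r; [apply mu_nonneg|apply H].
Qed.

Lemma expect_shift (r : nat) (c : Z) (F : Z -> R) : tempered F ->
  zsummable (fun d => F d * mu b r (d - c)) /\
  zsum (fun d => F d * mu b r (d - c)) = expect r (fun d => F (d + c)%Z).
Proof.
  intros HF. assert (HQ := ratio_bounds).
  assert (H : zsummable (fun d => F d * mu b r (d - c))).
  { apply (zsummable_tempered_decays ratio); [lra|exact HF|].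
    apply (decays_shift ratio (- c)); [lra|apply decays_mu]. }
  assert (E : forall d, F (d + c)%Z * mu b r (d + c - c) = F (d + c)%Z * mu b r d).
  { intros d. do 2 f_equal. lia. }
  split; [exact H|]. unfold expect. rewrite <- (zsum_shift c _ H); [now apply zsum_ext|].
  apply (zsummable_ext (fun d => F (d + c)%Z * mu b r d)); [now symmetry|].
  now apply (zsummable_expect r (fun d => F (d + c)%Z)), tempered_shift.
Qed.

Lemma expect_mix (r c : nat) (F : Z -> R) : (c < b)%nat -> tempered F ->
  expect (b * r + c) F =
  carry_mean c (expect r (fun d => F (d + Z.of_nat c)%Z))
               (expect (S r) (fun d => F (d + (Z.of_nat c - Z.of_nat b))%Z)).
Proof.
  intros Hc HF. unfold carry_mean.
  destruct (expect_shift r (Z.of_nat c) F HF) as [Hno_carry <-].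
  destruct (expect_shift (S r) (Z.of_nat c - Z.of_nat b) F HF) as [Hcarry <-].
  rewrite <- !zsum_scal, <- zsum_plus by now apply zsummable_scal.
  apply zsum_ext. intros d. rewrite mu_mix by exact Hc. unfold carry_mean.
  replace (d - Z.of_nat c + Z.of_nat b)%Z with (d - (Z.of_nat c - Z.of_nat b))%Z by lia. ring.
Qed.

Lemma expect_0 (F : Z -> R) : expect 0 F = F 0%Z.
Proof.
  unfold expect. rewrite zsum_supported_at_0, mu_0; [apply Rmult_1_r|].
  intros d Hd. rewrite mu_0. destruct (Z.eqb_spec 0 d); [lia|ring].
Qed.

Lemma expect_const (r : nat) (k : R) : expect r (fun _ => k) = k.
Proof.
  transitivity (expect 0 (fun _ => k)); [|apply expect_0].
  apply (carry_harmonic_eq_at_0 (fun r => expect r (fun _ => k))).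
  intros q c Hc. now apply (expect_mix q c (fun _ => k)), tempered_const.
Qed.

Lemma expect_add_const (r : nat) (F : Z -> R) (k : R) : tempered F ->
  expect r (fun d => F d + k) = expect r F + k.
Proof. intros HF. now rewrite expect_plus, expect_const by auto using tempered_const. Qed.

Lemma expect_bounded (r : nat) (F : Z -> R) (K : R) :
  (forall d, Rabs (F d) <= K) -> Rabs (expect r F) <= K.
Proof.
  intros HF. assert (HT := tempered_bounded F K HF).
  assert (HF' : forall d, - K <= F d <= K) by (intros; now apply Rabs_le_between).
  apply Rabs_le. rewrite <- (expect_const r K) at 2. rewrite <- (expect_const r (- K)).
  split; apply expect_le; auto using tempered_const; apply HF'.
Qed.

(** * Mean and variance *)

Lemma expect_IZR_shift (r : nat) (c : Z) :
  expect r (fun d => IZR (d + c)) = expect r IZR + IZR c.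
Proof.
  rewrite <- expect_add_const by apply tempered_IZR. apply expect_ext. intros d. apply plus_IZR.
Qed.

Lemma expect_IZR (r : nat) : expect r IZR = 0.
Proof.
  assert (HB := INR_base_ge_2). rewrite <- (expect_0 IZR).
  apply (carry_harmonic_eq_at_0 (fun r => expect r IZR)).
  intros q c Hc. rewrite expect_mix by (exact Hc || apply tempered_IZR).
  rewrite !expect_IZR_shift, minus_IZR, <- !INR_IZR_INZ. unfold carry_mean.
  rewrite minus_INR by lia. field. lra.
Qed.

Lemma var_mu_expect (r : nat) : var_mu b r = expect r (fun d => IZR d ^ 2).
Proof.
  unfold var_mu. change (mean_mu b r) with (expect r IZR). rewrite expect_IZR.
  unfold expect. ring.
Qed.

Lemma var_mu_nonneg (r : nat) : 0 <= var_mu b r.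
Proof.
  rewrite var_mu_expect, <- (expect_const r 0).
  apply expect_le; auto using tempered_const, tempered_sqr. intros d. apply pow2_ge_0.
Qed.

Lemma expect_sqr_shift (r : nat) (c : Z) :
  expect r (fun d => IZR (d + c) ^ 2) = var_mu b r + IZR c ^ 2.
Proof.
  assert (HT : tempered (fun d => 2 * IZR c * IZR d)).
  { apply tempered_mult; [apply tempered_const|apply tempered_IZR]. }
  rewrite var_mu_expect.
  rewrite (expect_ext _ _ (fun d => (IZR d ^ 2 + 2 * IZR c * IZR d) + IZR c ^ 2))
    by (intros d; rewrite plus_IZR; ring).
  rewrite expect_add_const, expect_plus, expect_scal, expect_IZR
    by auto using tempered_plus, tempered_sqr.
  ring.
Qed.

Lemma var_mu_mix (r c : nat) : (c < b)%nat ->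
  var_mu b (b * r + c) = carry_mean c (var_mu b r) (var_mu b (S r)) + INR c * INR (b - c).
Proof.
  intros Hc. assert (HB := INR_base_ge_2).
  rewrite var_mu_expect, expect_mix by (exact Hc || apply tempered_sqr).
  rewrite !expect_sqr_shift, minus_IZR, <- !INR_IZR_INZ. unfold carry_mean.
  rewrite minus_INR by lia. field. lra.
Qed.

Lemma var_mu_0 : var_mu b 0 = 0.
Proof. rewrite var_mu_expect, expect_0. ring. Qed.

Definition slope (r : nat) : R := var_mu b (S r) - var_mu b r.

Lemma slope_mix (r c : nat) : (c < b)%nat ->
  slope (b * r + c) = slope r / INR b + INR b - 1 - 2 * INR c.
Proof.
  intros Hc. assert (HB := INR_base_ge_2). unfold slope.
  destruct (Nat.eq_dec (S c) b) as [E|E].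
  - replace (S (b * r + c)) with (b * S r + 0)%nat by lia.
    rewrite !var_mu_mix by lia. unfold carry_mean.
    rewrite !minus_INR, <- E, S_INR by lia. rewrite <- E, S_INR in HB. simpl INR. field. lra.
  - replace (S (b * r + c)) with (b * r + S c)%nat by lia.
    rewrite !var_mu_mix by lia. unfold carry_mean.
    rewrite !minus_INR, S_INR by lia. field. lra.
Qed.

Lemma INR_digit_bounds (c : nat) : (c < b)%nat -> 0 <= INR c <= INR b - 1.
Proof.
  intros Hc. split; [apply pos_INR|]. apply le_INR in Hc. rewrite S_INR in Hc. lra.
Qed.

Lemma Rdiv_base_between (x : R) : - INR b <= x <= INR b -> -1 <= x / INR b <= 1.
Proof.
  assert (HB := INR_base_ge_2). intros Hx. split; [apply Rle_div_r|apply Rle_div_l]; lra.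
Qed.

Lemma slope_bounds (r : nat) : - INR b <= slope r <= INR b.
Proof.
  assert (HB := INR_base_ge_2). induction r as [|r c Hc IH] using base_ind.
  - assert (E := slope_mix 0 0 ltac:(lia)). rewrite Nat.mul_0_r in E. simpl in E.
    assert (Hs : slope 0 = slope 0 / INR b * INR b) by (field; lra).
    assert (E' : slope 0 / INR b = 1); [|rewrite Hs, E'; lra].
    apply Rmult_eq_reg_r with (INR b - 1); lra.
  - rewrite slope_mix by exact Hc. apply Rdiv_base_between in IH.
    assert (H := INR_digit_bounds c Hc). lra.
Qed.

(** * The variance grows with the number of blocks *)

Definition gap (r : nat) : R := INR b ^ 2 - slope r ^ 2.

Lemma gap_nonneg (r : nat) : 0 <= gap r.
Proof.
  assert (H := slope_bounds r). unfold gap.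
  replace (INR b ^ 2 - slope r ^ 2) with ((INR b - slope r) * (INR b + slope r)) by ring.
  apply Rmult_le_pos; lra.
Qed.

Definition energy (r : nat) : R := var_mu b r + slope r / 2 + slope r ^ 2 / 4.

(* Completing the square makes the increment of the variance independent of the digit. *)
Lemma energy_mix (r c : nat) : (c < b)%nat ->
  energy (b * r + c) = energy r + (1 - / INR b ^ 2) / 4 * gap r.
Proof.
  intros Hc. assert (HB := INR_base_ge_2). unfold energy, gap.
  rewrite slope_mix, var_mu_mix by exact Hc. unfold carry_mean. rewrite minus_INR by lia.
  replace (var_mu b (S r)) with (var_mu b r + slope r) by (unfold slope; ring).
  field. lra.
Qed.

Lemma gap_middle_digit (r c : nat) : (0 < c < b - 1)%nat -> 2 <= gap (b * r + c).
Proof.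
  intros Hc. assert (Hx := Rdiv_base_between _ (slope_bounds r)).
  assert (Hc1 : 1 <= INR c) by (apply (le_INR 1); lia).
  assert (Hc2 := INR_digit_bounds (S c) ltac:(lia)). rewrite S_INR in Hc2.
  unfold gap. rewrite slope_mix by lia. nra.
Qed.

Lemma gap_end_digit (x : R) : -1 <= x <= 1 -> x * INR b <= INR b - 2 ->
  2 <= INR b ^ 2 - (x + INR b - 1) ^ 2.
Proof.
  intros Hx Hs. assert (HB := INR_base_ge_2).
  replace (INR b ^ 2 - (x + INR b - 1) ^ 2) with ((1 - x) * (2 * INR b - 1 + x)) by ring.
  nra.
Qed.

Lemma gap_zero_after_nonzero (r c : nat) : (0 < c < b)%nat ->
  2 <= gap (b * (b * r + c) + 0).
Proof.
  intros Hc. assert (HB := INR_base_ge_2).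
  assert (Hx := Rdiv_base_between _ (slope_bounds r)).
  assert (Hy := Rdiv_base_between _ (slope_bounds (b * r + c))).
  assert (Hc1 : 1 <= INR c) by (apply (le_INR 1); lia).
  unfold gap. rewrite (slope_mix (b * r + c) 0) by lia.
  set (y := slope (b * r + c) / INR b) in *.
  replace (y + INR b - 1 - 2 * INR 0) with (y + INR b - 1) by (simpl; ring).
  apply gap_end_digit; [exact Hy|].
  replace (y * INR b) with (slope (b * r + c)) by (unfold y; field; lra).
  rewrite slope_mix by lia. lra.
Qed.

Lemma gap_max_after_nonmax (r c : nat) : (c < b - 1)%nat ->
  2 <= gap (b * (b * r + c) + (b - 1)).
Proof.
  intros Hc.
  assert (Hx := Rdiv_base_between _ (slope_bounds r)).
  assert (Hy := Rdiv_base_between _ (slope_bounds (b * r + c))).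
  assert (Hc2 := INR_digit_bounds (S c) ltac:(lia)). rewrite S_INR in Hc2.
  unfold gap. rewrite (slope_mix (b * r + c) (b - 1)), minus_INR by lia.
  set (y := slope (b * r + c) / INR b) in *.
  replace ((y + INR b - 1 - 2 * (INR b - INR 1)) ^ 2) with ((- y + INR b - 1) ^ 2)
    by (simpl; ring).
  apply gap_end_digit; [lra|].
  replace (- y * INR b) with (- slope (b * r + c)) by (unfold y; field; lra).
  rewrite slope_mix by lia. lra.
Qed.

Lemma block_start_gap (r k : nat) : block_start b r (S k) = true -> 2 <= gap (r / b ^ k).
Proof.
  intros Hstart. apply andb_prop in Hstart. destruct Hstart as [_ Hclass].
  replace (S k - 1)%nat with k in Hclass by lia.
  assert (Hlow := digit_lt r k). assert (Hhigh := digit_lt r (S k)).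
  rewrite (div_pow_digit r k), (div_pow_digit r (S k)).
  set (low := digit b r k) in *. set (high := digit b r (S k)) in *.
  set (p := (r / b ^ S (S k))%nat) in *. unfold dclass in Hclass.
  destruct (Nat.eqb_spec high 0) as [High0|High0], (Nat.eqb_spec high (b - 1)) as [HighMax|HighMax],
    (Nat.eqb_spec low 0) as [Low0|Low0], (Nat.eqb_spec low (b - 1)) as [LowMax|LowMax];
    try lia; try discriminate Hclass;
    first [ apply gap_middle_digit; lia
          | rewrite LowMax; apply gap_max_after_nonmax; lia
          | rewrite Low0; apply gap_zero_after_nonzero; lia ].
Qed.

(* The gap term makes each digit contribute the gap it creates instead of the previous one;
   [3 / 16] is the value at [b = 2] of the coefficient [(1 - / b ^ 2) / 4] in [energy_mix]. *)
Definition potential (r : nat) : R := energy r + 3 / 16 * gap r.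

Lemma potential_mix (r c : nat) : (c < b)%nat ->
  potential r + 3 / 16 * gap (b * r + c) <= potential (b * r + c).
Proof.
  intros Hc. assert (HI := inv_base_bounds). assert (G := gap_nonneg r).
  unfold potential. rewrite energy_mix by exact Hc.
  rewrite <- pow_inv. assert ((/ INR b) ^ 2 <= / 4) by nra. nra.
Qed.

Lemma block_count_potential (r L : nat) :
  potential (r / b ^ L) + 3 / 8 * INR (length (filter (block_start b r) (seq 1 L)))
  <= potential r.
Proof.
  induction L as [|L IH].
  - rewrite Nat.pow_0_r, Nat.div_1_r. simpl. lra.
  - rewrite seq_S, filter_app, length_app, plus_INR. change (1 + L)%nat with (S L).
    assert (Hmix := potential_mix (r / b ^ S L) (digit b r L) (digit_lt r L)).
    rewrite <- div_pow_digit in Hmix.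
    assert (G := gap_nonneg (r / b ^ L)). assert (Hstart := block_start_gap r L). cbn [filter].
    destruct (block_start b r (S L)); [specialize (Hstart eq_refl)|];
      simpl (INR (length _)) at 2; lra.
Qed.

Lemma potential_bounds (r : nat) : - / 4 <= potential r <= var_mu b r + INR b ^ 2 / 2.
Proof.
  assert (HB := INR_base_ge_2). assert (G := gap_nonneg r). assert (S := slope_bounds r).
  assert (V := var_mu_nonneg r). assert (Q := pow2_ge_0 (slope r + 1)).
  unfold potential, energy. split; [lra|]. unfold gap in *. nra.
Qed.

Lemma var_mu_ge_rho (r : nat) : 3 / 8 * INR (rho b r) - INR b ^ 2 <= var_mu b r.
Proof.
  assert (HB := INR_base_ge_2).
  assert (Hcount := block_count_potential r r).
  assert (Hlow := potential_bounds (r / b ^ r)). assert (Hup := potential_bounds r).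
  assert (Hrho : INR (rho b r) <= 1 + INR (length (filter (block_start b r) (seq 1 r)))).
  { unfold rho. cbn [seq filter]. destruct (block_start b r 0); cbn [length]; rewrite ?S_INR; lra. }
  nra.
Qed.

(** * Normal approximation *)

Lemma Rabs_carry_mean_le (c : nat) (x y : R) :
  Rabs (carry_mean c x y) <= carry_mean c (Rabs x) (Rabs y).
Proof.
  assert (HB := INR_base_ge_2).
  assert (W : forall k, 0 <= INR k / INR b).
  { intros k. apply Rdiv_le_0_compat; [apply pos_INR|lra]. }
  eapply Rle_trans; [apply Rabs_triang|].
  rewrite !Rabs_mult, !(Rabs_right (INR _ / INR b)) by apply Rle_ge, W. apply Rle_refl.
Qed.

Lemma var_mu_digit_diff (r c : nat) : (c < b)%nat ->
  Rabs (var_mu b r - var_mu b (b * r + c)) <= 2 * INR b ^ 2 /\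
  Rabs (var_mu b (S r) - var_mu b (b * r + c)) <= 2 * INR b ^ 2.
Proof.
  intros Hc.  assert (Hk := INR_digit_bounds c Hc).
  assert (Hx := Rdiv_base_between _ (slope_bounds r)).
  assert (E : var_mu b (b * r + c)
              = var_mu b r + INR c * (slope r / INR b) + INR c * (INR b - INR c)).
  { rewrite var_mu_mix by exact Hc. unfold carry_mean, slope.
    rewrite minus_INR by lia. field. lra. }
  assert (E' : var_mu b (S r) = var_mu b r + INR b * (slope r / INR b))
    by (unfold slope; field; lra).
  rewrite E, E'. split; apply Rabs_le; nra.
Qed.

Section HeatFlow.

Variables (g gx gxx : R -> R -> R) (e M K h : R).
Hypothesis Hg : heat_expansion e M g gx gxx.
Hypothesis HM : 0 <= M.
Hypothesis HK : forall t x, Rabs (g t x) <= K.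
Hypothesis Hh : Rabs h <= 1.

Definition clock (r : nat) : R := e + h ^ 2 * var_mu b r.

Definition step_error : R :=
  M * ((2 * INR b ^ 2) ^ 2 + 2 * INR b ^ 2 * INR b + INR b ^ 3) * Rabs h ^ 3.

Lemma step_error_nonneg : 0 <= step_error.
Proof.
  assert (HB := INR_base_ge_2). unfold step_error.
  apply Rmult_le_pos; [apply Rmult_le_pos; [exact HM|]|apply pow_le, Rabs_pos].
  assert (0 <= INR b ^ 2) by apply pow2_ge_0. assert (0 <= INR b ^ 3) by (apply pow_le; lra).
  assert (0 <= (2 * INR b ^ 2) ^ 2) by apply pow2_ge_0. nra.
Qed.

Lemma clock_ge (r : nat) : e <= clock r.
Proof.
  assert (H : 0 <= h ^ 2 * var_mu b r)
    by (apply Rmult_le_pos; [apply pow2_ge_0|apply var_mu_nonneg]).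
  unfold clock. lra.
Qed.

Lemma clock_remainder (r r' : nat) (x y : R) :
  Rabs (var_mu b r - var_mu b r') <= 2 * INR b ^ 2 -> Rabs y <= INR b ->
  Rabs (g (clock r) (x + h * y) - g (clock r') x - h * y * gx (clock r') x
        - h ^ 2 * ((var_mu b r - var_mu b r') + y ^ 2) / 2 * gxx (clock r') x) <= step_error.
Proof.
  intros Hr Hy.
  replace (clock r) with (clock r' + h ^ 2 * (var_mu b r - var_mu b r'))
    by (unfold clock; ring).
  apply (heat_expansion_scaled e); auto using clock_ge.
  replace (clock r' + _) with (clock r) by (unfold clock; ring). apply clock_ge.
Qed.

(* The increments of the clock and the displacements [h c], [h (c - b)] satisfy [E y = 0] and
   [E (s + y^2) = 0], so that only the remainders survive. *)
Lemma carry_mean_heat (r c : nat) (x : R) : (c < b)%nat ->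
  Rabs (carry_mean c (g (clock r) (x + h * INR c)) (g (clock (S r)) (x + h * (INR c - INR b)))
        - g (clock (b * r + c)) x) <= step_error.
Proof.
  intros Hc.  assert (Hk := INR_digit_bounds c Hc).
  destruct (var_mu_digit_diff r c Hc) as [Vlow Vhigh].
  assert (Rem0 := clock_remainder r (b * r + c) x (INR c) Vlow ltac:(apply Rabs_le; lra)).
  assert (Rem1 := clock_remainder (S r) (b * r + c) x (INR c - INR b) Vhigh
                  ltac:(apply Rabs_le; lra)).
  match type of Rem0 with Rabs ?X0 <= _ => match type of Rem1 with Rabs ?X1 <= _ =>
    replace (carry_mean c _ _ - _) with (carry_mean c X0 X1) end end.
  - eapply Rle_trans; [apply Rabs_carry_mean_le|].
    rewrite <- (carry_mean_diag c step_error) by lia. now apply carry_mean_le.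
  - rewrite var_mu_mix by exact Hc. unfold carry_mean.
    rewrite minus_INR by lia. field. lra.
Qed.

Lemma carry_mean_heat_weighted (r c : nat) (x : R) : (c < b)%nat ->
  Rabs (carry_mean c (g (clock r) (x + h * INR c)) (g (clock (S r)) (x + h * (INR c - INR b)))
        - g (clock (b * r + c)) x) <= step_error * (INR c * INR (b - c)).
Proof.
  intros Hc. assert (HE := step_error_nonneg). destruct (Nat.eq_dec c 0) as [->|Hc0].
  - assert (E : clock (b * r + 0) = clock r).
    { unfold clock. rewrite var_mu_mix, carry_mean_0 by exact Hc. simpl INR. ring. }
    rewrite E, carry_mean_0. simpl INR.
    rewrite Rmult_0_r, Rplus_0_r, Rminus_diag, Rabs_R0. lra.
  - eapply Rle_trans; [now apply carry_mean_heat|].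
    assert (1 <= INR c) by (apply (le_INR 1); lia).
    assert (1 <= INR (b - c)) by (apply (le_INR 1); lia).
    assert (1 <= INR c * INR (b - c)) by nra. nra.
Qed.

Definition heat_error (r : nat) (x : R) : R :=
  expect r (fun d => g e (x + h * IZR d)) - g (clock r) x.

Lemma heat_error_mix (r c : nat) (x : R) : (c < b)%nat ->
  Rabs (heat_error (b * r + c) x) <=
  carry_mean c (Rabs (heat_error r (x + h * INR c)))
               (Rabs (heat_error (S r) (x + h * (INR c - INR b))))
  + step_error * (INR c * INR (b - c)).
Proof.
  intros Hc.
  assert (Shift : forall q d0, expect q (fun d => g e (x + h * IZR (d + d0)))
                  = expect q (fun d => g e ((x + h * IZR d0) + h * IZR d))).
  { intros q d0. apply expect_ext. intros d. f_equal. rewrite plus_IZR. ring. }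
  assert (Step := carry_mean_heat_weighted r c x Hc).
  match type of Step with Rabs ?local_error <= _ =>
    replace (heat_error (b * r + c) x)
      with (carry_mean c (heat_error r (x + h * INR c))
              (heat_error (S r) (x + h * (INR c - INR b))) + local_error) end.
  - eapply Rle_trans; [apply Rabs_triang|].
    apply Rplus_le_compat; [apply Rabs_carry_mean_le|exact Step].
  - unfold heat_error. rewrite (expect_mix r c (fun d => g e (x + h * IZR d)))
      by (exact Hc || (apply (tempered_bounded _ K); intros; apply HK)).
    rewrite !Shift, minus_IZR, <- !INR_IZR_INZ. unfold carry_mean. ring.
Qed.

(* The error obeys the same digit recursion as the variance, so that
   [sup_norm (heat_error r) - step_error * var_mu b r] is subharmonic. *)
Lemma heat_error_le (r : nat) (x : R) : Rabs (heat_error r x) <= step_error * var_mu b r.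
Proof.
  assert (Hbound : forall q y, Rabs (heat_error q y) <= K + K).
  { intros q y. eapply Rle_trans; [apply Rabs_triang|]. rewrite Rabs_Ropp.
    apply Rplus_le_compat; [apply expect_bounded; intros; apply HK|apply HK]. }
  assert (Hsup : forall q y, Rabs (heat_error q y) <= sup_norm (heat_error q)).
  { intros q. apply (sup_norm_spec _ (K + K)), Hbound. }
  eapply Rle_trans; [apply Hsup|]. apply Rminus_le_0, Ropp_le_cancel. rewrite Ropp_0.
  set (excess := fun q => sup_norm (heat_error q) - step_error * var_mu b q).
  replace (- _) with (excess r) by (unfold excess; ring).
  apply Rle_trans with (excess 0%nat).
  - apply carry_subharmonic_le_at_0. intros q c Hc. unfold excess.
    assert (Hmix : sup_norm (heat_error (b * q + c)) <=
      carry_mean c (sup_norm (heat_error q)) (sup_norm (heat_error (S q)))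
      + step_error * (INR c * INR (b - c))).
    { apply sup_norm_spec. intros y. eapply Rle_trans; [now apply heat_error_mix|].
      apply Rplus_le_compat_r. now apply carry_mean_le. }
    rewrite var_mu_mix by exact Hc. unfold carry_mean in *. lra.
  - unfold excess. rewrite var_mu_0, Rmult_0_r, Rminus_0_r.
    apply sup_norm_spec. intros y. unfold heat_error, clock.
    rewrite expect_0, var_mu_0, !Rmult_0_r, !Rplus_0_r, Rminus_diag, Rabs_R0. apply Rle_refl.
Qed.

End HeatFlow.

Lemma expect_heat_normalized (e : R) : 0 < e ->
  exists C, 0 <= C /\ forall r x, 1 <= Defs.sigma b r ->
  Rabs (expect r (fun d => heat e (x - IZR d / Defs.sigma b r)) - heat (e + 1) x)
  <= C / Defs.sigma b r.
Proof.
  intros He. set (M := 4 * (/ sqrt e) ^ 3 + 4 * (/ sqrt e) ^ 4).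
  assert (HM : 0 <= M).
  { assert (HI : 0 <= / sqrt e) by (apply Rlt_le, Rinv_0_lt_compat, sqrt_lt_R0, He).
    apply Rplus_le_le_0_compat; apply Rmult_le_pos; try (now apply pow_le); lra. }
  exists (step_error M 1). split; [now apply step_error_nonneg|].
  intros r x. set (s := Defs.sigma b r). intros Hs.
  assert (Hvar : var_mu b r = s ^ 2) by (symmetry; apply pow2_sqrt, var_mu_nonneg).
  assert (Habs : Rabs (- / s) = / s).
  { rewrite Rabs_Ropp. apply Rabs_right, Rle_ge, Rlt_le, Rinv_0_lt_compat. lra. }
  assert (H := heat_error_le heat heat_x heat_xx e M 1 (- / s)
                 (heat_expansion_heat e He) HM heat_bounded
                 ltac:(rewrite Habs, <- Rinv_1; apply Rinv_le_contravar; lra) r x).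
  unfold heat_error, clock, step_error in *. rewrite Hvar, Habs in H.
  replace (e + (- / s) ^ 2 * s ^ 2) with (e + 1) in H by (field; lra).
  rewrite (expect_ext r _ (fun d => heat e (x + - / s * IZR d)))
    by (intros d; f_equal; unfold Rdiv; ring).
  eapply Rle_trans; [exact H|]. right. rewrite Rabs_R1. field. lra.
Qed.

Lemma cdf_tilde_expect (r : nat) (x : R) :
  cdf_tilde b r x = expect r (fun d => indicator_le x (IZR d / Defs.sigma b r)).
Proof.
  apply zsum_ext. intros d. unfold indicator_le. destruct (Rle_dec _ _); ring.
Qed.

Lemma cdf_tilde_between (t h x : R) (r : nat) (s := Defs.sigma b r) : 0 < t ->
  expect r (fun d => heat t (x - h - IZR d / s)) - heat t (- h) <= cdf_tilde b r x <=
  expect r (fun d => heat t (x + h - IZR d / s)) + heat t (- h).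
Proof.
  intros Ht.
  assert (HT : forall y, tempered (fun d => heat t (y - IZR d / s))).
  { intros y. apply (tempered_bounded _ 1). intros d. apply heat_bounded. }
  assert (HI : tempered (fun d => indicator_le x (IZR d / s))).
  { apply (tempered_bounded _ 1). intros d. apply indicator_le_bounded. }
  rewrite cdf_tilde_expect. unfold Rminus at 1.
  rewrite <- !expect_add_const by apply HT. split; apply expect_le;
    auto using tempered_plus, tempered_const; intros d.
  - now apply indicator_le_lower.
  - now apply indicator_le_upper.
Qed.

Lemma cdf_tilde_near_Phi (x eps : R) : 0 < eps ->
  exists A, forall r, A <= Defs.sigma b r -> Rabs (cdf_tilde b r x - Phi x) < eps.
Proof.
  intros Heps.
  destruct (smoothing_parameters x (eps / 2) ltac:(lra)) as (t & h & Ht & Hup & Hlow).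
  destruct (expect_heat_normalized t Ht) as (C & HC & Hexp).
  assert (HCe : 0 <= 2 * C / eps) by (apply Rdiv_le_0_compat; lra).
  exists (1 + 2 * C / eps). intros r Hs.
  assert (B := cdf_tilde_between t h x r Ht).
  assert (Bup := Hexp r (x + h) ltac:(lra)). assert (Blow := Hexp r (x - h) ltac:(lra)).
  set (s := Defs.sigma b r) in *. cbv zeta in B.
  assert (Hsmall : C / s < eps / 2).
  { apply Rlt_div_l; [lra|]. replace C with (eps / 2 * (2 * C / eps)) by (field; lra).
    apply Rmult_lt_compat_l; lra. }
  apply Rabs_le_between in Bup, Blow. apply Rabs_lt_between. lra.
Qed.

Lemma sigma_large (A : R) : exists m, forall r, (m <= rho b r)%nat -> A <= Defs.sigma b r.
Proof.
  destruct (INR_unbounded (8 / 3 * (A ^ 2 + INR b ^ 2))) as [m Hm].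
  exists m. intros r Hr. apply le_INR in Hr. assert (H := var_mu_ge_rho r).
  apply Rle_trans with (sqrt (A ^ 2)).
  - rewrite <- Rsqr_pow2, sqrt_Rsqr_abs. apply Rle_abs.
  - apply sqrt_le_1_alt. lra.
Qed.

End Base.

Theorem theorem2 (b : nat) (Hb : (2 <= b)%nat) (rs : nat -> nat)
  (Hr : forall n, (1 <= rs n)%nat)
  (Hrho : forall M : nat, exists N : nat, forall n, (N <= n)%nat -> (M <= rho b (rs n))%nat) :
  conv_dist_std_normal (fun n => cdf_tilde b (rs n)).
Proof.
  intros x. apply is_lim_seq_spec. intros eps.
  destruct (cdf_tilde_near_Phi b Hb x eps (cond_pos eps)) as [A HA].
  destruct (sigma_large b Hb A) as [M HM].
  destruct (Hrho M) as [N HN].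
  exists N. intros n Hn. apply HA, HM, HN, Hn.
Qed.
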